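(* Let $r,n\ge 2$ be integers. Then there exist a discrete valuation domain $(R,pR)$ with finite residue field and valuation $\mathsf{v}$, and a primitive non-constant polynomial $f\in R[x]$ with $\mathsf{v}(\operatorname{d}(f))=n$, such that $F=\frac{f}{p^n}\in\operatorname{Int}(R)$ is irreducible but not absolutely irreducible in $\operatorname{Int}(R)$, every reduced fdp matrix of $f$ has rank $r$, and the minimal exponent $S\in\mathbb{N}$ for which $F^S$ does not factor uniquely in $\operatorname{Int}(R)$ satisfies (1) $S=(n+1)\big((n-1)^{r-1}+(n-1)^{r-2}\big)$, and (2) $S=(n+1)\min\{\|\mathbf{v}^+\|_\infty+\|\mathbf{v}^-\|_\infty\mid \mathbf{0}\neq\mathbf{v}\in\operatorname{fdk}(f)\cap\mathbb{Z}^{\mathcal{P}}\}$, where $\mathcal{P}$ is an irreducible divisor set of $f$.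
   Context: For a discrete valuation domain $(R,pR)$ with valuation $\mathsf{v}$ and quotient field $K$: $\operatorname{Int}(R)=\{F\in K[x]\mid F(R)\subseteq R\}$; for $f\in R[x]$, $\operatorname{d}(f)=\gcd(f(a)\mid a\in R)$, so $\mathsf{v}(\operatorname{d}(f))=\min_{a\in R}\mathsf{v}(f(a))$. An irreducible divisor set $\mathcal{P}$ of $f$ is a set of representatives of the associate classes of irreducible divisors of $f$ in $R[x]$. $\mathcal{W}(f)=\{a\in R\mid \mathsf{v}(f(a))=\mathsf{v}(\operatorname{d}(f))\}$ and $\operatorname{fdk}(f)=\{(u_g)\in\mathbb{Q}^{\mathcal{P}}\mid \forall a\in\mathcal{W}(f):\sum_g u_g\mathsf{v}(g(a))=0\}$. An fdp matrix of $f$ is a matrix $A\in\mathbb{Q}^{W\times\mathcal{P}}$, $W$ a finite set, with $\ker(A)=\operatorname{fdk}(f)$; it is reduced if its rows are $\mathbb{Q}$-linearly independent. For $\mathbf{u}\in\mathbb{Q}^{\mathcal{P}}$, $\mathbf{u}^+=\max(\mathbf{u},\mathbf{0})$, $\mathbf{u}^-=-\min(\mathbf{u},\mathbf{0})$ componentwise, and $\|\mathbf{u}\|_\infty=\max_g|u_g|$. An element factors uniquely if all its factorizations into irreducibles are essentially the same (same number of factors, pairwise associated after reindexing); an irreducible $r$ is absolutely irreducible if $r^k$ factors uniquely for all $k\in\mathbb{N}$. *)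

(* Defs.v *)
From HB Require Import structures.
From mathcomp Require Import all_boot all_order all_algebra fraction.
Unset Printing Implicit Defensive.
Import Order.TTheory GRing.Theory Num.Theory.
Local Open Scope ring_scope.

(* Throughout: R is an integral domain, p : R a prime element generating the
   maximal ideal, v : R -> nat the p-adic valuation on nonzero elements
   (v 0 is irrelevant: it is never used, since v(0) = oo). *)

(** Divisibility in a commutative ring (genuine, not pseudo-division). *)
Definition rdvd {A : comNzRingType} (a b : A) : Prop := exists c, b = c * a.

Definition is_dvr {R : idomainType} (p : R) (v : R -> nat) : Prop :=
  [/\ p != 0, p \isn't a GRing.unit &
      forall a : R, a != 0 -> exists2 u : R, u \is a GRing.unit & a = u * p ^+ v a].

Definition finite_residue {R : idomainType} (p : R) : Prop :=
  exists s : seq R, forall a : R, exists2 b, b \in s & rdvd p (a - b).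

Definition primitive {R : idomainType} (f : {poly R}) : Prop :=
  forall c : R, (forall i, rdvd c f`_i) -> c \is a GRing.unit.

(** v(d(f)) = n, where d(f) = gcd(f(a) | a in R), i.e. n = min_a v(f(a)). *)
Definition vd_eq {R : idomainType} (v : R -> nat) (f : {poly R}) (n : nat) : Prop :=
  (exists a : R, f.[a] != 0 /\ v f.[a] = n) /\
  (forall b : R, f.[b] != 0 -> (n <= v f.[b])%N).

Definition inW {R : idomainType} (v : R -> nat) (f : {poly R}) (a : R) : Prop :=
  f.[a] != 0 /\ vd_eq v f (v f.[a]).

Definition pirr {R : idomainType} (g : {poly R}) : Prop :=
  [/\ g != 0, g \isn't a GRing.unit &
      forall a b : {poly R}, g = a * b -> a \is a GRing.unit \/ b \is a GRing.unit].

Definition passoc {R : idomainType} (g h : {poly R}) : Prop :=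
  exists2 u : {poly R}, u \is a GRing.unit & g = u * h.

Definition irr_div_set {R : idomainType} (f : {poly R}) (P : seq {poly R}) : Prop :=
  [/\ forall g, g \in P -> pirr g /\ rdvd g f,
      forall i j, (i < size P)%N -> (j < size P)%N -> passoc P`_i P`_j -> i = j &
      forall g, pirr g -> rdvd g f -> exists2 h, h \in P & passoc g h].

Definition in_fdk {R : idomainType} (v : R -> nat) (f : {poly R}) (P : seq {poly R})
    (u : 'I_(size P) -> rat) : Prop :=
  forall a : R, inW v f a -> \sum_(i < size P) u i * (v (P`_i).[a])%:R = 0.

Definition fdp_matrix {R : idomainType} (v : R -> nat) (f : {poly R}) (P : seq {poly R})
    {k : nat} (A : 'M[rat]_(k, size P)) : Prop :=
  forall u : 'cV[rat]_(size P), A *m u = 0 <-> in_fdk v f P (fun i => u i 0).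

Definition reduced {k m : nat} (A : 'M[rat]_(k, m)) : bool := row_free A.

Definition norm_pm {m : nat} (w : 'I_m -> int) : nat :=
  (\max_(i < m) absz (Num.max (w i) 0) + \max_(i < m) absz (Num.max (- w i) 0))%N.

Definition min_norm_fdk {R : idomainType} (v : R -> nat) (f : {poly R}) (P : seq {poly R})
    (m : nat) : Prop :=
  (exists w : 'I_(size P) -> int,
      (exists i, w i != 0) /\ in_fdk v f P (fun i => (w i)%:~R) /\ norm_pm w = m) /\
  (forall w : 'I_(size P) -> int,
      (exists i, w i != 0) -> in_fdk v f P (fun i => (w i)%:~R) -> (m <= norm_pm w)%N).

Definition toK {R : idomainType} (a : R) : {fraction R} := @FracField.tofrac R a.

Definition IntR {R : idomainType} (F : {poly {fraction R}}) : Prop :=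
  forall a : R, exists b : R, F.[toK a] = toK b.

Definition Int_unit {R : idomainType} (F : {poly {fraction R}}) : Prop :=
  IntR F /\ exists2 G, IntR G & F * G = 1.

Definition Int_irr {R : idomainType} (F : {poly {fraction R}}) : Prop :=
  [/\ IntR F, F != 0, ~ Int_unit F &
      forall G H, IntR G -> IntR H -> F = G * H -> Int_unit G \/ Int_unit H].

Definition Int_assoc {R : idomainType} (F G : {poly {fraction R}}) : Prop :=
  exists2 u, Int_unit u & F = u * G.

Definition Int_factorization {R : idomainType} (F : {poly {fraction R}})
    (s : seq {poly {fraction R}}) : Prop :=
  (forall g, g \in s -> Int_irr g) /\ \prod_(g <- s) g = F.

Definition ess_same {R : idomainType} (s t : seq {poly {fraction R}}) : Prop :=
  size s = size t /\
  exists2 t', perm_eq t t' & forall i, (i < size s)%N -> Int_assoc s`_i t'`_i.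

Definition Int_factors_uniquely {R : idomainType} (F : {poly {fraction R}}) : Prop :=
  forall s t, Int_factorization F s -> Int_factorization F t -> ess_same s t.

Definition Int_abs_irr {R : idomainType} (F : {poly {fraction R}}) : Prop :=
  Int_irr F /\ forall k : nat, Int_factors_uniquely (F ^+ k).

Definition divpn {R : idomainType} (p : R) (n : nat) (f : {poly R}) : {poly {fraction R}} :=
  (toK p ^- n) *: map_poly (@toK R) f.

(* Main.v *)
Require Import Defs.
From HB Require Import structures.
From mathcomp Require Import all_boot all_order all_algebra fraction qpoly.
From mathcomp Require Import zify ring.
From Stdlib Require Import Classical.
Import Order.TTheory GRing.Theory Num.Theory.
Local Open Scope ring_scope.
Set Implicit Arguments.
Unset Strict Implicit.

(** Let [R] be the localization of [Z] at an odd prime [q >= r + 2], and let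
    [f = g_0 ... g_r] with monic irreducible [g_i] such that [v (g_i a)] depends only
    on the residue class [s] of [a] modulo [q]. The vectors [(v (g_i a))_i] are
    [e_s + (n-1) e_(s+1)] for [r-1] of the classes, [(n+1) e_0] and [(n+1) e_1] for two
    further classes, and [n e_r] otherwise. Then [W(f)] consists of the classes whose
    vector has sum [n], and the kernel of the fixed divisor matrix is spanned by
    [w = ((n-1)^(r-1), -(n-1)^(r-2), ..., +-1, 0)].

    A factor of [F^k] in [Int(R)] is, up to units, [p^(-nc) prod_i g_i^(c + t w_i)] with
    integers [c] and [t], and its cofactor has exponents [k - c - t w_i]. Integrality of
    both on the classes [(n+1) e_0] and [(n+1) e_1] amounts to
    [c >= (n+1) |t| max w^-] and [k - c >= (n+1) |t| max w^+] (for [t > 0]; the two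
    maxima are swapped for [t < 0]), so that [t = 0] unless
    [k >= (n+1) (max w^+ + max w^-) = S]; for [k = S] the case [t = 1] does occur.

    The [g_i] arise from products of polynomials [(x - s)^N - q^m], which have valuation
    exactly [m] on the class [s], by a perturbation modulo [q^N] that makes them
    Eisenstein at [2]. *)

(** * Fractions and integer-valued polynomials *)

HB.instance Definition _ (R : idomainType) :=
  GRing.RMorphism.copy (@toK R) (@FracField.tofrac R).

Section Fractions.
Variable R : idomainType.
Local Notation K := {fraction R}.

Lemma toK_eq0 (a : R) : (toK a == 0) = (a == 0).
Proof. exact: tofrac_eq0. Qed.

Lemma toK_inj : injective (@toK R).
Proof. by move=> a b /eqP; rewrite /toK tofrac_eq => /eqP. Qed.

Lemma fraction_quotient (x : K) : exists a b : R, b != 0 /\ x = toK a / toK b.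
Proof.
elim/quotW: x => y; exists \n_y, \d_y; split; first exact: denom_ratioP.
have d0 := denom_ratioP y.
apply: (canRL (mulfK _)); first by rewrite toK_eq0.
rewrite /toK [FracField.tofrac \d_y]piE [FracField.tofrac \n_y]piE.
rewrite -[LHS]/(FracField.mul _ _) -FracField.pi_mul; apply/eqmodP => /=.
rewrite FracField.equivfE !numden_Ratio ?mulf_neq0 ?oner_neq0 //.
by rewrite !mulr1 mulrC.
Qed.

Lemma clear_denominators (a : {poly K}) :
  exists2 c : R, c != 0 & exists a' : {poly R}, toK c *: a = map_poly (@toK R) a'.
Proof.
elim/poly_ind: a => [|a x [c c0 [a' ha]]].
  by exists 1; rewrite ?oner_neq0 //; exists 0; rewrite scaler0 map_poly0.
have [n [d [d0 ->]]] := fraction_quotient x.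
exists (c * d); first by rewrite mulf_neq0.
exists (d *: a' * 'X + (c * n)%:P).
have -> : map_poly (@toK R) (d *: a' * 'X + (c * n)%:P) =
    toK d *: map_poly (@toK R) a' * 'X + (toK c * toK n)%:P.
  by rewrite rmorphD /= [map_poly _ (_ * 'X)]rmorphM /= map_polyX map_polyZ map_polyC /= rmorphM.
rewrite -ha scalerDr scalerA -!scalerAl rmorphM [toK d * _]mulrC.
by rewrite -[_ *: _%:P]mul_polyC -polyCM -mulrA [toK d * _]mulrC mulfVK ?toK_eq0.
Qed.

End Fractions.

Lemma size_proper_factors (D : idomainType) (a b : {poly D}) :
  (1 < size a)%N -> (1 < size b)%N -> (size a < size (a * b)%R)%N /\ (size b < size (a * b)%R)%N.
Proof. by move=> ha hb; rewrite size_mul -?size_poly_gt0; lia. Qed.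

(** * Units and factorizations in [Int(R)] *)

Section IntegerValued.
Variable R : idomainType.
Local Notation K := {fraction R}.
Implicit Types F G : {poly K}.

Lemma IntR1 : IntR (1 : {poly K}).
Proof. by move=> a; exists 1; rewrite hornerC rmorph1. Qed.

Lemma IntRM F G : IntR F -> IntR G -> IntR (F * G).
Proof.
move=> hF hG a; have [b hb] := hF a; have [c hc] := hG a.
by exists (b * c); rewrite hornerM hb hc rmorphM.
Qed.

Lemma IntR_prod (s : seq {poly K}) :
  (forall g, g \in s -> IntR g) -> IntR (\prod_(g <- s) g).
Proof.
elim: s => [|g s IH] H; first by rewrite big_nil; exact: IntR1.
rewrite big_cons; apply: IntRM; first by apply: H; rewrite mem_head.
by apply: IH => h hs; apply: H; rewrite inE hs orbT.
Qed.

Lemma IntRX F k : IntR F -> IntR (F ^+ k).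
Proof.
by move=> hF; elim: k => [|k IH]; rewrite ?expr0 ?exprS; [exact: IntR1|exact: IntRM].
Qed.

(** By degrees, both factors of 1 are constants; their values at 0 put these constants in [R], where
    they are inverse to each other. *)
Lemma Int_unitP F :
  Int_unit F <-> exists2 u : R, u \is a GRing.unit & F = (toK u)%:P.
Proof.
split=> [[hF [G hG FG]]|[u hu ->]].
  have F0 : F != 0 by apply: contra_eq_neq FG => ->; rewrite mul0r eq_sym oner_neq0.
  have G0 : G != 0 by apply: contra_eq_neq FG => ->; rewrite mulr0 eq_sym oner_neq0.
  have : size (F * G) == 1%N by rewrite FG size_poly1.
  rewrite size_mul_eq1 => /andP[/eqP sF /eqP sG].
  have EF := size1_polyC (eq_leq sF); have EG := size1_polyC (eq_leq sG).
  have [b hb] := hF 0; have [c hc] := hG 0.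
  rewrite EF hornerC in hb; rewrite EG hornerC in hc.
  exists b; last by rewrite EF hb.
  apply/unitrPr; exists c; apply: (@toK_inj R); rewrite rmorphM rmorph1 /= -hb -hc.
  by apply: polyC_inj; rewrite polyCM -EF -EG.
split; first by move=> a; exists u; rewrite hornerC.
exists (toK u^-1)%:P; first by move=> a; exists u^-1; rewrite hornerC.
by rewrite -polyCM -rmorphM divrr // rmorph1.
Qed.

Lemma Int_unitM F G : Int_unit F -> Int_unit G -> Int_unit (F * G).
Proof.
move=> /Int_unitP[u hu ->] /Int_unitP[w hw ->]; apply/Int_unitP.
by exists (u * w); rewrite ?unitrM ?hu // -polyCM -rmorphM.
Qed.

Lemma Int_unit1 : Int_unit (1 : {poly K}).
Proof. by apply/Int_unitP; exists 1; rewrite ?unitr1 // rmorph1. Qed.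

(* The condition that divisors of degree 0 are units guarantees that the
   degree drops in every proper factorization. *)
Lemma Int_factorization_exists (B : {poly K}) : B != 0 ->
  (forall F G, IntR F -> IntR G -> F * G = B -> (size F <= 1)%N -> Int_unit F) ->
  forall F G, IntR F -> IntR G -> F * G = B -> ~ Int_unit F ->
  exists s, Int_factorization F s.
Proof.
move=> B0 HB F; have [m] := ubnP (size F); elim: m F => // m IH F hm G hF hG FG nu.
have F0 : F != 0 by apply: contraNneq B0 => F0; rewrite -FG F0 mul0r.
have [irr|nirr] := classic (Int_irr F).
  by exists [:: F]; split=> [g|]; rewrite ?big_seq1 // inE => /eqP->.
have [H1 [H2 [h1 h2 E n1 n2]]] : exists H1 H2, [/\ IntR H1, IntR H2, F = H1 * H2,
    ~ Int_unit H1 & ~ Int_unit H2].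
  apply: NNPP => N; apply: nirr; split=> // H1 H2 h1 h2 E.
  apply: NNPP => N'; apply: N; exists H1, H2; split=> // U; apply: N'; tauto.
(* Each [Hi] again divides [B] with an integer-valued cofactor, so by [HB] a nonunit [Hi] is not
   constant and the degrees of both factors drop. *)
have E1 : H1 * (H2 * G) = B by rewrite mulrA -E.
have E2 : H2 * (H1 * G) = B by rewrite mulrA [H2 * _]mulrC -E.
have s1 : (1 < size H1)%N.
  by rewrite ltnNge; apply/negP => /(HB _ _ h1 (IntRM h2 hG) E1).
have s2 : (1 < size H2)%N.
  by rewrite ltnNge; apply/negP => /(HB _ _ h2 (IntRM h1 hG) E2).
have [l1 l2] := size_proper_factors s1 s2; rewrite -E in l1 l2.
have [t1 [I1 P1]] := IH H1 (leq_trans l1 hm) _ h1 (IntRM h2 hG) E1 n1.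
have [t2 [I2 P2]] := IH H2 (leq_trans l2 hm) _ h2 (IntRM h1 hG) E2 n2.
exists (t1 ++ t2); split; last by rewrite big_cat P1 P2.
by move=> g; rewrite mem_cat => /orP[/I1|/I2].
Qed.

End IntegerValued.

(** * The valuation on the fraction field *)

Section Valuation.
Variables (R : idomainType) (p : R) (v : R -> nat).
Hypothesis dvr : is_dvr p v.
Local Notation K := {fraction R}.
Local Notation pK := (toK p).

Lemma uniformizer_neq0 : p != 0. Proof. by case: dvr. Qed.

Lemma toK_uniformizer_neq0 : pK != 0.
Proof. by rewrite toK_eq0 uniformizer_neq0. Qed.

Lemma unit_mul_expp_inj (u w : R) k l : u \is a GRing.unit -> w \is a GRing.unit ->
  u * p ^+ k = w * p ^+ l -> k = l.
Proof.
wlog kl : u w k l / (k <= l)%N => [H hu hw E|hu hw E].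
  by case/orP: (leq_total k l) => h; [exact: (H u w)|symmetry; exact: (H w u)].
case: dvr => p0 pu _; have := subnKC kl; case: (l - k)%N => [|d] dl; first by lia.
case/negP: pu; move: E; rewrite -dl exprD mulrCA [u * _]mulrC.
move=> /(mulfI (expf_neq0 _ p0)) E; move: hu; rewrite E exprS.
by rewrite !unitrM => /andP[_ /andP[]].
Qed.

Lemma valE (u : R) k : u \is a GRing.unit -> v (u * p ^+ k) = k.
Proof.
move=> hu; case: (dvr) => p0 pu H.
have n0 : u * p ^+ k != 0.
  by rewrite mulf_neq0 ?expf_neq0 //; apply: contraTneq hu => ->; rewrite unitr0.
have [w hw E] := H _ n0; symmetry; exact: (unit_mul_expp_inj hu hw E).
Qed.

Lemma toK_unit_exp_inj (u w : R) (y z : int) : u \is a GRing.unit -> w \is a GRing.unit ->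
  toK u * pK ^ y = toK w * pK ^ z -> y = z.
Proof.
move=> hu hw E; have p0 := toK_uniformizer_neq0.
(* Multiplication by [pK ^ m] makes both exponents nonnegative and brings the equation down to
   [R]. *)
pose m : int := `|y| + `|z|.
have [k hk] : exists k : nat, y + m = k by exists (absz (y + m)); lia.
have [l hl] : exists l : nat, z + m = l by exists (absz (z + m)); lia.
suff : k = l by lia.
apply: (unit_mul_expp_inj hu hw); apply: (@toK_inj R).
rewrite !rmorphM !rmorphXn /= !exprnP -hk -hl !expfzDr // !mulrA.
by rewrite E.
Qed.

(** Turns integrality of a value into a sign condition, so that integer-valuedness of products of
    the [g i] becomes a system of linear inequalities in the exponents. *)
Lemma toK_unit_exp_integral (u : R) (z : int) : u \is a GRing.unit ->
  (exists b, toK u * pK ^ z = toK b) <-> 0 <= z.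
Proof.
move=> hu; split=> [[b E]|].
  case: (dvr) => _ _ H.
  have b0 : b != 0.
    rewrite -toK_eq0 -E mulf_neq0 ?expfz_neq0 ?toK_uniformizer_neq0 // toK_eq0.
    by apply: contraTneq hu => ->; rewrite unitr0.
  have [w hw Eb] := H b b0; move: E; rewrite Eb rmorphM rmorphXn /= exprnP.
  by move=> /(toK_unit_exp_inj hu hw) ->.
by case: z => // k _; exists (u * p ^+ k); rewrite rmorphM rmorphXn.
Qed.

Lemma fraction_unit_exp (c : K) : c != 0 ->
  exists2 u : R, u \is a GRing.unit & exists z : int, c = toK u * pK ^ z.
Proof.
have [a [b [b0 ->]]] := fraction_quotient c => c0.
have a0 : a != 0 by apply: contraNneq c0 => ->; rewrite rmorph0 mul0r.
case: (dvr) => p0 _ H; have [u hu Ea] := H a a0; have [w hw Eb] := H b b0.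
exists (u / w); first by rewrite unitrM hu unitrV.
exists ((v a)%:Z - (v b)%:Z).
rewrite {1}Ea {1}Eb !rmorphM !rmorphXn /= expfzDr ?toK_uniformizer_neq0 //.
rewrite -exprnP -exprnN rmorphV //= invfM !mulrA; congr (_ * _).
by rewrite -!mulrA; congr (_ * _); rewrite mulrC.
Qed.

End Valuation.

(** * The matrix of valuations *)

(* [valmx r n s i] is the valuation that the [i]-th irreducible factor of [f] will
   take on the [s]-th residue class. The classes [r] and [r.+1], on which the row
   sum is [n.+1], are the ones outside [W(f)]; all other rows sum to [n]. *)
Definition valmx (r n s i : nat) : nat :=
  if (s < r.-1)%N then ((i == s) + n.-1 * (i == s.+1))%N
  else if s == r then (n.+1 * (i == 0))%N
  else if s == r.+1 then (n.+1 * (i == 1))%N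
  else (n * (i == r))%N.

(** Solves [x s + (n - 1) x (s+1) = 0] downwards from an entry [+1] or [-1] at [r.-1]. This entry
    makes the vector generate the integral kernel over the integers, not only the rational one over
    the rationals. *)
Definition kergen (r n i : nat) : int :=
  if (i < r)%N then (-1) ^+ i * (n.-1)%:Z ^+ (r.-1 - i) else 0.

Section ValuationMatrix.
Variables r n : nat.
Hypotheses (r2 : (2 <= r)%N) (n2 : (2 <= n)%N).
Local Notation M := (valmx r n).
Local Notation w := (kergen r n).

Lemma sum_mul_delta (A : pzRingType) (x : nat -> A) m k j : (j < m)%N ->
  \sum_(i < m) x i * ((k * (i == j :> nat))%N)%:R = x j * k%:R.
Proof.
move=> jm; rewrite (bigD1 (Ordinal jm)) //= eqxx muln1 big1 ?addr0 // => i ij.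
by rewrite (negbTE (ij : (i : nat) != j)) muln0 mulr0.
Qed.

Lemma sum_valmx (A : pzRingType) (x : nat -> A) s :
  \sum_(i < r.+1) x i * (M s i)%:R =
  if (s < r.-1)%N then x s + x s.+1 * (n.-1)%:R
  else if s == r then x 0%N * (n.+1)%:R
  else if s == r.+1 then x 1%N * (n.+1)%:R
  else x r * n%:R.
Proof.
rewrite /valmx; case: ltnP => hs; last first.
  by case: eqP => _; [|case: eqP => _]; rewrite sum_mul_delta //; lia.
rewrite -(sum_mul_delta x (m := r.+1) n.-1 (j := s.+1)); last by lia.
rewrite -[x s]mulr1 -(sum_mul_delta x (m := r.+1) 1 (j := s)); last by lia.
by rewrite -big_split /=; apply: eq_bigr => i _; rewrite -mulrDr -natrD mul1n.
Qed.

(** The bound [n.+2] later serves as the exponent [N] in the construction of the [g i], which has to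
    exceed all prescribed valuations. *)
Lemma valmx_lt s i : (M s i < n.+2)%N.
Proof.
rewrite /valmx; case: ifP => _; last by case: eqP => _; [|case: eqP => _]; case: (i == _); lia.
by case: (i =P s) => [->|_]; case: eqP => //; lia.
Qed.

(** Keeps the polynomial built for column [i] from being constant. *)
Lemma valmx_positive_column i : (i <= r)%N -> exists2 s, (s < r.+2)%N & (0 < M s i)%N.
Proof.
case: i => [|i] ir.
  by exists r => //; rewrite /valmx; case: (ltnP r r.-1) => [|_]; rewrite ?eqxx /=; lia.
have [ir'|ir'] := ltnP i r.-1; first by exists i; rewrite /valmx ?ir' ?eqxx; lia.
exists r.-1; rewrite /valmx ?ltnn; first by lia.
have -> : (r.-1 == r) = false by lia.
have -> : (r.-1 == r.+1) = false by lia.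
have -> : i.+1 == r by lia.
by lia.
Qed.

(** Separates the [g i] by their valuations. The class [r] singles out column 0; for [i > 0] the
    class [i - 1] is positive at [i] and zero at every later column. *)
Lemma valmx_columns_distinct i j : (i < j)%N -> (j <= r)%N ->
  exists2 s, (s < r.+2)%N & M s i != M s j.
Proof.
move=> ij jr; case: i ij => [|i] ij.
  exists r => //; rewrite /valmx; case: (ltnP r r.-1) => [|_]; first by lia.
  rewrite eqxx; have -> : (j == 0)%N = false by lia.
  by lia.
exists i; first by lia.
rewrite /valmx; have -> : (i < r.-1)%N by lia.
have -> : (i.+1 == i) = false by lia.
have -> : (j == i) = false by lia.
have -> : (j == i.+1) = false by lia.
by rewrite eqxx; lia.
Qed.

Lemma kergen_rec s : (s < r.-1)%N -> w s = - (n.-1)%:Z * w s.+1.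
Proof.
move=> hs; rewrite /kergen.
have -> : (s < r)%N by lia.
have -> : (s.+1 < r)%N by lia.
have -> : (r.-1 - s = (r.-1 - s.+1).+1)%N by lia.
by rewrite !exprS; ring.
Qed.

Lemma kergen_last : w r = 0. Proof. by rewrite /kergen ltnn. Qed.

Lemma kergen0 : w 0%N = ((n.-1) ^ r.-1)%N%:Z.
Proof.
rewrite /kergen; have -> : (0 < r)%N by lia.
by rewrite expr0 mul1r subn0 -!natz natrX.
Qed.

Lemma kergen1 : w 1%N = - ((n.-1) ^ r.-2)%N%:Z.
Proof.
rewrite /kergen; have -> : (1 < r)%N by lia.
by rewrite expr1 mulN1r subn1 -!natz natrX.
Qed.

Lemma kergen_unit : w r.-1 = 1 \/ w r.-1 = -1.
Proof.
rewrite /kergen; have -> : (r.-1 < r)%N by lia.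
by rewrite subnn expr0 mulr1 -signr_odd; case: odd; [right|left].
Qed.

(** The signs alternate and the absolute values never increase with the index, so the extremes are
    attained at the indices 0 and 1. *)
Lemma kergen_bounds i : - ((n.-1) ^ r.-2)%N%:Z <= w i <= ((n.-1) ^ r.-1)%N%:Z.
Proof.
rewrite /kergen; case: ltnP => ir; last by lia.
have E : (n.-1)%:Z ^+ (r.-1 - i) = (n.-1 ^ (r.-1 - i))%N%:Z by rewrite -!natz natrX.
rewrite E -signr_odd; have n1 : (0 < n.-1)%N by lia.
have h1 : (n.-1 ^ (r.-1 - i) <= n.-1 ^ r.-1)%N by rewrite leq_pexp2l //; lia.
have h3 : (0 < n.-1 ^ (r.-1 - i))%N by rewrite expn_gt0 n1.
case O : (odd i); rewrite ?expr1 ?expr0 ?mulN1r ?mul1r; last by lia.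
have h2 : (n.-1 ^ (r.-1 - i) <= n.-1 ^ r.-2)%N.
  by rewrite leq_pexp2l //; case: (i) O => // j _; lia.
by lia.
Qed.

Lemma kergen_in_kernel s : s != r -> s != r.+1 ->
  \sum_(i < r.+1) w i * (M s i)%:R = 0.
Proof.
move=> /negbTE s1 /negbTE s2; rewrite sum_valmx s1 s2 kergen_last mul0r.
by case: ifP => // /kergen_rec ->; rewrite natz; ring.
Qed.

(** The class [r.-1] forces [x r = 0], and the other classes determine the entries downwards from
    [r.-1]. As [w r.-1] is its own inverse, the multiplier is found without division, and the result
    applies to integer and rational vectors alike. *)
Lemma kernel_valmx (A : numDomainType) (x : nat -> A) :
  (forall s, (s < r)%N -> \sum_(i < r.+1) x i * (M s i)%:R = 0) ->
  forall i, (i <= r)%N -> x i = (w r.-1)%:~R * x r.-1 * (w i)%:~R.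
Proof.
move=> H.
have xr : x r = 0.
  have := H r.-1; rewrite sum_valmx ltnn.
  have -> : (r.-1 == r) = false by lia.
  have -> : (r.-1 == r.+1) = false by lia.
  have lt : (r.-1 < r)%N by lia.
  move=> /(_ lt) /eqP; rewrite mulf_eq0 pnatr_eq0 => /orP[/eqP//|].
  by have -> : (n == 0)%N = false by lia.
have E j : (j <= r.-1)%N -> x (r.-1 - j)%N = (w r.-1)%:~R * x r.-1 * (w (r.-1 - j)%N)%:~R.
  elim: j => [_|j IH jr].
    rewrite subn0; case: kergen_unit => ->; rewrite ?rmorphN ?rmorph1 /=; ring.
  have lt : (r.-1 - j.+1 < r)%N by lia.
  have := H _ lt; rewrite sum_valmx.
  have -> : (r.-1 - j.+1 < r.-1)%N by lia.
  have ->: ((r.-1 - j.+1).+1 = r.-1 - j)%N by lia.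
  move=> /eqP; rewrite addr_eq0 => /eqP ->; rewrite IH; last by lia.
  rewrite [w (r.-1 - j.+1)]kergen_rec; last by lia.
  have ->: ((r.-1 - j.+1).+1 = r.-1 - j)%N by lia.
  by rewrite !rmorphM !rmorphN /=; ring.
move=> i; rewrite leq_eqVlt => /orP[/eqP->|ir].
  by rewrite xr kergen_last rmorph0 mulr0.
have -> : i = (r.-1 - (r.-1 - i))%N by lia.
by apply: E; lia.
Qed.

(** * The threshold exponent *)

Definition threshold := (n.+1 * ((n.-1) ^ r.-1 + (n.-1) ^ r.-2))%N.

Lemma thresholdE : threshold = (n.+1 * n * (n.-1) ^ r.-2)%N.
Proof.
rewrite /threshold -mulnA; congr (_ * _)%N.
have -> : (r.-1 = r.-2.+1)%N by lia.
by rewrite expnS; case: n n2 => // m _; rewrite mulSn addnC.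
Qed.

Lemma threshold_gt1 : (1 < threshold)%N.
Proof.
rewrite thresholdE; have : (0 < n.-1 ^ r.-2)%N by rewrite expn_gt0; lia.
by nia.
Qed.

(* The valuation of [p ^ z * prod_i g_i ^ e_i] on the class [s]. *)
Definition monoval (z : int) (e : nat -> nat) (s : nat) : int :=
  z + \sum_(i < r.+1) (e i)%:Z * (M s i)%:R.

(* On the classes in [W(f)] both valuations vanish, which puts [e1 - e1 r] into
   the kernel; the classes [r] and [r.+1] then force [threshold <= k] unless
   this kernel element is zero. *)
Lemma split_below_threshold (k : nat) (e1 e2 : nat -> nat) (z1 z2 : int) :
  (k < threshold)%N -> (forall i, e1 i + e2 i = k)%N -> z1 + z2 = - (k * n)%N%:Z ->
  (forall s, (s < r.+2)%N -> 0 <= monoval z1 e1 s) ->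
  (forall s, (s < r.+2)%N -> 0 <= monoval z2 e2 s) ->
  (forall i, (i <= r)%N -> e1 i = e1 r) /\ z1 = - (e1 r * n)%N%:Z.
Proof.
move=> kS eK zK h1 h2.
have e2E i : (e2 i)%:Z = k%:Z - (e1 i)%:Z by rewrite -(eK i); lia.
pose x i : int := (e1 i)%:Z - (e1 r)%:Z.
have valE (e : nat -> nat) z s : monoval z e s = z +
    (if (s < r.-1)%N then (e s)%:Z + (e s.+1)%:Z * (n.-1)%:Z
     else if s == r then (e 0)%:Z * (n.+1)%:Z
     else if s == r.+1 then (e 1)%:Z * (n.+1)%:Z
     else (e r)%:Z * n%:Z).
  by rewrite /monoval (sum_valmx (fun i => (e i)%:Z)) !natz.
have ltr : (r < r.-1)%N = false by lia.
have ltr1 : (r.+1 < r.-1)%N = false by lia.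
have neq1 : (r.-1 == r) = false by lia.
have neq2 : (r.-1 == r.+1) = false by lia.
have neq3 : (r.+1 == r) = false by lia.
have z1E : z1 = - (e1 r * n)%N%:Z.
  have lt : (r.-1 < r.+2)%N by lia.
  have := h1 _ lt; have := h2 _ lt; rewrite !valE ltnn neq1 neq2 e2E; nia.
have hx s : (s < r)%N -> \sum_(i < r.+1) x i * (M s i)%:R = 0.
  move=> sr; rewrite sum_valmx.
  have -> : (s == r) = false by lia.
  have -> : (s == r.+1) = false by lia.
  case: ifP => hs; last by rewrite /x subrr mul0r.
  have lt : (s < r.+2)%N by lia.
  have := h1 _ lt; have := h2 _ lt; rewrite !valE hs !e2E z1E /x natz.
  have -> : z2 = - (k * n)%N%:Z + (e1 r * n)%N%:Z by lia.
  have -> : (n.-1)%:Z = n%:Z - 1 by lia.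
  by nia.
have X := kernel_valmx hx.
set c : int := (w r.-1)%:~R * x r.-1 in X.
have x0 : x 0%N = c * ((n.-1) ^ r.-1)%N%:Z.
  by rewrite X // kergen0 intz.
have x1 : x 1%N = - (c * ((n.-1) ^ r.-2)%N%:Z).
  by rewrite X ?kergen1 ?intz ?mulrN //; lia.
suff c0 : c = 0.
  by split=> // i ir; have := X i ir; rewrite c0 mul0r /x; lia.
have a1 := h1 r (leqnSn _); have a2 := h2 r (leqnSn _).
have b1 := h1 r.+1 (ltnSn _); have b2 := h2 r.+1 (ltnSn _).
rewrite !valE ltr eqxx e2E in a1 a2; rewrite !valE ltr1 neq3 eqxx e2E in b1 b2.
case: (eqVneq c 0) => // c0; exfalso; move: kS; rewrite /threshold ltnNge => /negP; apply.
move: x0 x1; rewrite /x.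
set A := (_ ^ r.-1)%N; set B := (_ ^ r.-2)%N => x0 x1.
have z2E : z2 = - (k * n)%N%:Z + (e1 r * n)%N%:Z by lia.
have E0 : (e1 0%N)%:Z = (e1 r)%:Z + c * A%:Z by lia.
have E1 : (e1 1%N)%:Z = (e1 r)%:Z - c * B%:Z by lia.
rewrite z1E z2E E0 E1 in a1 a2 b1 b2.
(* For [c > 0] the sum of [a2'] and [b1'] bounds [k] from below; for [c < 0] it is the sum of [a1']
   and [b2']. *)
have a1' : 0 <= (e1 r)%:Z + c * (A%:Z * (n.+1)%:Z) by nia.
have a2' : 0 <= k%:Z - (e1 r)%:Z - c * (A%:Z * (n.+1)%:Z) by nia.
have b1' : 0 <= (e1 r)%:Z - c * (B%:Z * (n.+1)%:Z) by nia.
have b2' : 0 <= k%:Z - (e1 r)%:Z + c * (B%:Z * (n.+1)%:Z) by nia.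
clear - c0 a1' a2' b1' b2'.
suff : ((n.+1 * (A + B))%N%:Z <= k%:Z) by lia.
have [cp|cn] : (1 <= c) \/ (c <= -1) by lia.
  have : A%:Z * (n.+1)%:Z <= c * (A%:Z * (n.+1)%:Z) by apply: ler_peMl => //; nia.
  have : B%:Z * (n.+1)%:Z <= c * (B%:Z * (n.+1)%:Z) by apply: ler_peMl => //; nia.
  by lia.
have cn' : 1 <= - c by lia.
have : A%:Z * (n.+1)%:Z <= - c * (A%:Z * (n.+1)%:Z) by apply: ler_peMl => //; nia.
have : B%:Z * (n.+1)%:Z <= - c * (B%:Z * (n.+1)%:Z) by apply: ler_peMl => //; nia.
by lia.
Qed.

(* The exponents realising the bound of [split_below_threshold]: they differ from
   constants by the kernel generator. *)
Definition splitexp1 (i : nat) : nat := absz ((n.+1 * (n.-1) ^ r.-2)%N%:Z + w i).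
Definition splitexp2 (i : nat) : nat := absz ((n.+1 * (n.-1) ^ r.-1)%N%:Z - w i).

Lemma splitexp1E i : (splitexp1 i)%:Z = (n.+1 * (n.-1) ^ r.-2)%N%:Z + w i.
Proof. by rewrite /splitexp1; have := kergen_bounds i; nia. Qed.

Lemma splitexp2E i : (splitexp2 i)%:Z = (n.+1 * (n.-1) ^ r.-1)%N%:Z - w i.
Proof. by rewrite /splitexp2; have := kergen_bounds i; nia. Qed.

Lemma splitexp_sum i : (splitexp1 i + splitexp2 i)%N = threshold.
Proof. by have := splitexp1E i; have := splitexp2E i; rewrite /threshold; nia. Qed.

(** Both valuations vanish on the classes in [W(f)]. Outside, the constants are just large enough:
    the first valuation is 0 on the class [r.+1], the second on the class [r]. *)
Lemma splitexp_monoval s :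
  0 <= monoval (- (n * (n.+1 * (n.-1) ^ r.-2))%N%:Z) splitexp1 s /\
  0 <= monoval (- (n * (n.+1 * (n.-1) ^ r.-1))%N%:Z) splitexp2 s.
Proof.
have pr : (n.-1 ^ r.-1 = n.-1 * n.-1 ^ r.-2)%N.
  by rewrite -expnS; congr (_ ^ _)%N; lia.
rewrite /monoval !(sum_valmx (fun i => (_ i)%:Z)) !splitexp1E !splitexp2E !natz.
rewrite kergen0 kergen1 kergen_last pr.
set B := (_ ^ _)%N.
case: ltnP => hs; last by case: eqP => _; [|case: eqP => _]; split; nia.
rewrite (kergen_rec hs) /=; have -> : (n.-1)%:Z = n%:Z - 1 by lia.
by split; nia.
Qed.

(** A power of [F] has equal valuations on these two classes, so a factor with exponents [splitexp1]
    is not a unit times such a power. *)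
Lemma splitexp1_monoval_neq z : monoval z splitexp1 r != monoval z splitexp1 r.+1.
Proof.
rewrite /monoval !(sum_valmx (fun i => (_ i)%:Z)) !splitexp1E !natz.
have -> : (r < r.-1)%N = false by lia.
have -> : (r.+1 < r.-1)%N = false by lia.
have -> : (r.+1 == r) = false by lia.
rewrite !eqxx kergen0 kergen1.
have hA : (0 < n.-1 ^ r.-1)%N by rewrite expn_gt0; lia.
have hB : (0 < n.-1 ^ r.-2)%N by rewrite expn_gt0; lia.
by apply/eqP; nia.
Qed.

Lemma monoval_const k s : monoval (- (k * n)%N%:Z) (fun=> k) s =
  if (s == r) || (s == r.+1) then k%:Z else 0.
Proof.
rewrite /monoval (sum_valmx (fun=> k%:Z)) !natz.
case: (s =P r) => [->|_] /=.
  have -> : (r < r.-1)%N = false by lia.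
  by nia.
case: (s =P r.+1) => [->|_].
  have -> : (r.+1 < r.-1)%N = false by lia.
  by nia.
by case: ifP => _; nia.
Qed.

End ValuationMatrix.

(** * Products of irreducibles with prescribed valuations *)

Section Monomials.
Variables (R : idomainType) (p : R) (v : R -> nat) (r n : nat) (g : nat -> {poly R}).
Hypothesis dvr : is_dvr p v.
Hypotheses (r2 : (2 <= r)%N) (n2 : (2 <= n)%N).
Hypothesis g_monic : forall i, (i <= r)%N -> g i \is monic.
Hypothesis g_irr : forall i, (i <= r)%N -> irreducible_poly (map_poly (@toK R) (g i)).

Local Notation K := {fraction R}.
Local Notation pK := (toK p).
Local Notation toKX := (map_poly (@toK R)).
Local Notation S := (threshold r n).

(** Replaces membership in a residue class by the valuations it prescribes, so that the section
    applies to any discrete valuation domain with suitable [g i]. All indices beyond [r.+1] describe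
    the same valuations as [r.-1]. *)
Definition in_class (a : R) (s : nat) : Prop :=
  forall i, (i <= r)%N -> exists2 u, u \is a GRing.unit & (g i).[a] = u * p ^+ valmx r n s i.

Hypothesis class_exists : forall a, exists s, in_class a s.
Hypothesis class_inhabited : forall s, (s < r.+2)%N -> exists a, in_class a s.

Definition mono (e : nat -> nat) : {poly R} := \prod_(i < r.+1) g i ^+ e i.

Definition monoK (u : R) (z : int) (e : nat -> nat) : {poly K} :=
  (toK u * pK ^ z) *: toKX (mono e).

Lemma mono_monic e : mono e \is monic.
Proof. by apply: monic_prod => i _; apply/monic_exp/g_monic; rewrite -ltnS. Qed.

Lemma eq_mono e1 e2 : (forall i, (i <= r)%N -> e1 i = e2 i) -> mono e1 = mono e2.
Proof. by move=> E; apply: eq_bigr => i _; rewrite E // -ltnS. Qed.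

Lemma monoD e1 e2 : mono (fun i => e1 i + e2 i)%N = mono e1 * mono e2.
Proof. by rewrite /mono -big_split; apply: eq_bigr => i _; rewrite exprD. Qed.

Lemma mono0 : mono (fun=> 0%N) = 1.
Proof. by rewrite /mono big1 // => i _; rewrite expr0. Qed.

Lemma monoX k : mono (fun=> k) = mono (fun=> 1%N) ^+ k.
Proof. by rewrite /mono -prodrXl; apply: eq_bigr => i _; rewrite expr1. Qed.

Lemma mono_delta i : (i <= r)%N -> mono (fun j => (j == i)%N) = g i.
Proof.
move=> ir; rewrite /mono (bigD1 (Ordinal (ir : (i < r.+1)%N))) //= eqxx expr1.
by rewrite big1 ?mulr1 // => j /negbTE ji; rewrite (ji : (nat_of_ord j == i) = false) expr0.
Qed.

Lemma mono_pull e i : (i <= r)%N -> (0 < e i)%N ->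
  mono e = g i * mono (fun j => e j - (j == i))%N.
Proof.
move=> ir ei; rewrite -{1}(mono_delta ir) -monoD; apply: eq_mono => j _.
by case: (j =P i) => [->|_]; rewrite /=; lia.
Qed.

Lemma horner_mono e a s : in_class a s ->
  exists2 u, u \is a GRing.unit & (mono e).[a] = u * p ^+ (\sum_(i < r.+1) e i * valmx r n s i).
Proof.
move=> cl; rewrite /mono horner_prod.
elim/big_ind2: _ => [|x1 k1 x2 k2 [u1 h1 ->] [u2 h2 ->]|i _].
- by exists 1; rewrite ?unitr1 // expr0 mulr1.
- by exists (u1 * u2); rewrite ?unitrM ?h1 // exprD mulrACA.
- have ir : (i <= r)%N by rewrite -ltnS.
  have [u hu E] := cl i ir; exists (u ^+ e i); first by rewrite unitrX.
  by rewrite horner_exp E exprMn -exprM mulnC.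
Qed.

Lemma horner_monoK u z e a s : u \is a GRing.unit -> in_class a s ->
  exists2 t, t \is a GRing.unit & (monoK u z e).[toK a] = toK t * pK ^ monoval r n z e s.
Proof.
move=> hu cl; have [t ht E] := horner_mono e cl; exists (u * t); first by rewrite unitrM hu.
rewrite /monoK hornerZ horner_map /= E !rmorphM rmorphXn /= exprnP /monoval.
rewrite expfzDr ?(toK_uniformizer_neq0 dvr) // mulrACA; congr (_ * (_ * pK ^ _)).
by rewrite -natz natr_sum; apply: eq_bigr => i _; rewrite natrM natz.
Qed.

Lemma monoK_IntR u z e : u \is a GRing.unit -> (forall s, 0 <= monoval r n z e s) ->
  IntR (monoK u z e).
Proof.
move=> hu H a; have [s cl] := class_exists a; have [t ht ->] := horner_monoK z e hu cl.
exact/(toK_unit_exp_integral dvr _ ht).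
Qed.

Lemma IntR_monoval u z e s : u \is a GRing.unit -> IntR (monoK u z e) -> (s < r.+2)%N ->
  0 <= monoval r n z e s.
Proof.
move=> hu H /class_inhabited[a cl]; have [t ht E] := horner_monoK z e hu cl.
by apply/(toK_unit_exp_integral dvr _ ht); rewrite -E; exact: H.
Qed.

Lemma monoKM u1 z1 e1 u2 z2 e2 : monoK u1 z1 e1 * monoK u2 z2 e2 =
  monoK (u1 * u2) (z1 + z2) (fun i => e1 i + e2 i)%N.
Proof.
rewrite /monoK monoD !rmorphM /= expfzDr ?(toK_uniformizer_neq0 dvr) //.
by rewrite -scalerAl -scalerAr scalerA; congr (_ *: _); rewrite mulrACA.
Qed.

(** Unique factorization in [K[x]], by induction on the total exponent: an irreducible [g i] of
    positive exponent either divides [a], or is coprime to [a] and divides [b]; it is then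
    cancelled. *)
Lemma divisor_mono e (c : K) (a b : {poly K}) : c != 0 -> a * b = c *: toKX (mono e) ->
  exists e1 e2 ca cb, [/\ a = ca *: toKX (mono e1), b = cb *: toKX (mono e2),
    forall i, (e1 i + e2 i)%N = e i & ca * cb = c].
Proof.
have [m] := ubnP (\sum_(i < r.+1) e i); elim: m e a b => // m IH e a b hm c0 E.
have [/forallP e0|] := boolP [forall i : 'I_r.+1, e i == 0]%N.
  have e0' : mono e = 1.
    rewrite -mono0; apply: eq_mono => i ir.
    by have /eqP := e0 (Ordinal (ir : (i < r.+1)%N)).
  have sab : size (a * b) == 1%N by rewrite E e0' rmorph1 alg_polyC size_polyC c0.
  move: sab; rewrite size_mul_eq1 => /andP[/eqP sa /eqP sb].
  have Ea := size1_polyC (eq_leq sa); have Eb := size1_polyC (eq_leq sb).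
  have z1 : toKX (mono (fun=> 0%N)) = 1 by rewrite mono0 rmorph1.
  (* Here [e] is known to vanish only up to [r]; taking it as first exponent vector makes the sum
     correct at every index. *)
  exists e, (fun=> 0%N), a`_0, b`_0; split.
  - by rewrite e0' rmorph1 alg_polyC.
  - by rewrite z1 alg_polyC.
  - by move=> i; rewrite addn0.
  - by apply: polyC_inj; rewrite polyCM -Ea -Eb E e0' rmorph1 alg_polyC.
rewrite negb_forall => /existsP[[i ir0] /= ei]; rewrite -lt0n in ei.
have ir : (i <= r)%N by rewrite -ltnS.
pose e' j := (e j - (j == i))%N.
have Ee' : forall j, (e j = (j == i) + e' j)%N.
  by move=> j; rewrite /e'; case: (j =P i) => [->|_] /=; lia.
have E' : mono e = g i * mono e' by exact: mono_pull.
have hm' : (\sum_(j < r.+1) e' j < m)%N.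
  move: hm; under eq_bigr do rewrite Ee'.
  rewrite big_split /= (bigD1 (Ordinal ir0)) //= eqxx; lia.
have [gi irr] := (g_irr ir, irreducible_poly_coprime a (g_irr ir)).
have gi0 : toKX (g i) != 0 := irredp_neq0 gi.
have div : toKX (g i) %| a * b.
  by rewrite E E' rmorphM /= dvdpZr ?dvdp_mulIl.
case: (boolP (toKX (g i) %| a)) => [|nd].
  rewrite dvdp_eq => /eqP Ea.
  have : (a %/ toKX (g i)) * b = c *: toKX (mono e').
    by apply: (mulIf gi0); rewrite mulrAC -Ea E E' rmorphM /= -scalerAl mulrC.
  move=> /(IH _ _ _ hm' c0)[e1 [e2 [ca [cb [E1 E2 E3 E4]]]]].
  exists (fun j => (j == i) + e1 j)%N, e2, ca, cb; split=> //.
    by rewrite Ea E1 monoD mono_delta // rmorphM /= -scalerAl mulrC.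
  by move=> j; rewrite Ee' -E3 addnA.
have cop : coprimep (toKX (g i)) a by rewrite irr.
move: div; rewrite Gauss_dvdpr // dvdp_eq => /eqP Eb.
have : a * (b %/ toKX (g i)) = c *: toKX (mono e').
  by apply: (mulIf gi0); rewrite -mulrA -Eb E E' rmorphM /= -scalerAl mulrC.
move=> /(IH _ _ _ hm' c0)[e1 [e2 [ca [cb [E1 E2 E3 E4]]]]].
exists e1, (fun j => (j == i) + e2 j)%N, ca, cb; split=> //.
  by rewrite Eb E2 monoD mono_delta // rmorphM /= -scalerAl mulrC.
by move=> j; rewrite Ee' -E3 addnCA.
Qed.

(** * Divisors and factorizations of the powers of [F] *)

Let f := mono (fun=> 1%N).
Let F := divpn p n f.

Lemma divpnX k : F ^+ k = monoK 1 (- (k * n)%N%:Z) (fun=> k).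
Proof.
rewrite /F /divpn exprZn /monoK monoX rmorphXn /= rmorph1 mul1r; congr (_ *: _).
by rewrite -exprVn -exprM exprVn mulnC exprnN.
Qed.

Lemma divpn_monoK : F = monoK 1 (- n%:Z) (fun=> 1%N).
Proof. by rewrite -[F]expr1 divpnX mul1n. Qed.

Lemma IntR_divpn : IntR F.
Proof.
rewrite divpn_monoK; apply: monoK_IntR; rewrite ?unitr1 // => s.
by have := monoval_const r2 n2 1 s; rewrite mul1n => ->; case: ifP.
Qed.

Lemma divisor_divpnX k (a b : {poly K}) : a * b = F ^+ k ->
  exists u1 u2 z1 z2 e1 e2, [/\ u1 \is a GRing.unit, u2 \is a GRing.unit,
    a = monoK u1 z1 e1, b = monoK u2 z2 e2 &
    (forall i, (e1 i + e2 i)%N = k) /\ z1 + z2 = - (k * n)%N%:Z].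
Proof.
rewrite divpnX => E; have c0 : toK 1 * pK ^ (- (k * n)%N%:Z) != 0.
  by rewrite rmorph1 mul1r expfz_neq0 // (toK_uniformizer_neq0 dvr).
have [e1 [e2 [ca [cb [Ea Eb Ee Ec]]]]] := divisor_mono c0 E.
have ca0 : ca != 0 by apply: contraNneq c0 => ca0; rewrite -Ec ca0 mul0r.
have cb0 : cb != 0 by apply: contraNneq c0 => cb0; rewrite -Ec cb0 mulr0.
have [u1 hu1 [z1 E1]] := fraction_unit_exp dvr ca0.
have [u2 hu2 [z2 E2]] := fraction_unit_exp dvr cb0.
exists u1, u2, z1, z2, e1, e2; split; rewrite // ?Ea ?Eb ?E1 ?E2 //; split=> //.
move: Ec; rewrite E1 E2 mulrACA -rmorphM -expfzDr ?(toK_uniformizer_neq0 dvr) //.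
by apply: (toK_unit_exp_inj dvr); rewrite ?unitr1 // unitrM hu1.
Qed.

(** Both factors satisfy the inequalities of [split_below_threshold], which makes their exponent
    vectors constant and fixes their powers of [p]. *)
Lemma divisor_divpnX_below k (a b : {poly K}) : (k < S)%N -> IntR a -> IntR b ->
  a * b = F ^+ k -> exists j1 j2 u1 u2, [/\ (j1 + j2 = k)%N,
    Int_unit u1, Int_unit u2, a = u1 * F ^+ j1 & b = u2 * F ^+ j2].
Proof.
move=> kS ha hb /divisor_divpnX[u1 [u2 [z1 [z2 [e1 [e2 [hu1 hu2 Ea Eb [Ee Ez]]]]]]]].
rewrite Ea in ha; rewrite Eb in hb.
have H1 s := IntR_monoval (s := s) hu1 ha; have H2 s := IntR_monoval (s := s) hu2 hb.
have [c1 z1E] := split_below_threshold r2 n2 kS Ee Ez H1 H2.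
have [c2 z2E] : (forall i, (i <= r)%N -> e2 i = e2 r) /\ z2 = - (e2 r * n)%N%:Z.
  by apply: (split_below_threshold r2 n2 kS (e2 := e1) (z2 := z1)) => // [i|];
     rewrite 1?addnC // addrC.
exists (e1 r), (e2 r), (toK u1)%:P, (toK u2)%:P; split=> //.
- by apply/Int_unitP; exists u1.
- by apply/Int_unitP; exists u2.
- by rewrite Ea divpnX z1E /monoK (eq_mono c1) rmorph1 mul1r mul_polyC scalerA.
- by rewrite Eb divpnX z2E /monoK (eq_mono c2) rmorph1 mul1r mul_polyC scalerA.
Qed.

Lemma size_mono1 : (1 < size f)%N.
Proof.
have r0 : (0 <= r)%N by [].
have [+ _] := g_irr r0; rewrite size_map_inj_poly ?rmorph0 //; last exact: toK_inj.
move=> h; rewrite /f (mono_pull r0) // size_monicM ?g_monic ?monic_neq0 ?mono_monic //.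
by have := monic_neq0 (mono_monic (fun j => 1 - (j == 0))%N); rewrite -size_poly_gt0; lia.
Qed.

Lemma size_divpn : (1 < size F)%N.
Proof.
rewrite /F /divpn size_scale ?invr_neq0 ?expf_neq0 ?(toK_uniformizer_neq0 dvr) //.
by rewrite size_map_inj_poly ?rmorph0 ?size_mono1 //; exact: toK_inj.
Qed.

Lemma divpn_nonunit : ~ Int_unit F.
Proof.
by move=> /Int_unitP[u _ E]; have := size_divpn; rewrite E size_polyC; case: eqP.
Qed.

Lemma size_unit_mul_divpnX u k : Int_unit u -> (size (u * F ^+ k)).-1 = ((size F).-1 * k)%N.
Proof.
move=> /Int_unitP[t ht ->]; rewrite mul_polyC size_scale ?size_exp // toK_eq0.
by apply: contraTneq ht => ->; rewrite unitr0.
Qed.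

Lemma unit_mul_divpnX_inj u w k l : Int_unit u -> Int_unit w ->
  u * F ^+ k = w * F ^+ l -> k = l.
Proof.
move=> hu hw /(congr1 (fun q : {poly K} => (size q).-1)).
rewrite !size_unit_mul_divpnX // => /eqP; rewrite eqn_pmul2l; first by move/eqP.
by rewrite -ltnS prednK ?size_divpn // (ltn_trans _ size_divpn).
Qed.

(** The exponent 1 lies below the threshold, so in a product of two factors equal to [F] one of them
    is a unit times [F ^+ 0]. *)
Lemma divpn_irr : Int_irr F.
Proof.
split; [exact: IntR_divpn | | exact: divpn_nonunit |].
  by rewrite -size_poly_gt0 (ltn_trans _ size_divpn).
move=> a b ha hb E; have E1 : a * b = F ^+ 1 by rewrite expr1.
have [j1 [j2 [u1 [u2 [j12 hu1 hu2 -> ->]]]]] :=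
  divisor_divpnX_below (threshold_gt1 r2 n2) ha hb E1.
case: j1 j12 => [|[|j1]] j12; first by left; rewrite expr0 mulr1.
  by right; case: j2 j12 => // _; rewrite expr0 mulr1.
by lia.
Qed.

Lemma irr_unit_mul_divpnX u j : Int_unit u -> Int_irr (u * F ^+ j) -> j = 1%N.
Proof.
move=> hu [hI _ nu irr]; case: j hI nu irr => [|[|j]] // _ nu irr.
  by case: nu; rewrite expr0 mulr1.
have hI : IntR (u * F) by apply: IntRM IntR_divpn; case: hu.
have E : u * F ^+ j.+2 = (u * F) * F ^+ j.+1 by rewrite -mulrA -exprS.
case: (irr _ _ hI (IntRX j.+1 IntR_divpn) E) => U.
  suff : 1%N = 0%N by [].
  by apply: (unit_mul_divpnX_inj hu U); rewrite expr1 expr0 mulr1.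
suff : j.+1 = 0%N by [].
by apply: (unit_mul_divpnX_inj (Int_unit1 R) U); rewrite mul1r expr0 mulr1.
Qed.

Lemma prod_assoc_divpn (s : seq {poly K}) :
  (forall h, h \in s -> Int_assoc h F) ->
  exists2 u, Int_unit u & \prod_(h <- s) h = u * F ^+ size s.
Proof.
elim: s => [|h s IH] H.
  by exists 1; [exact: Int_unit1 | rewrite big_nil expr0 mulr1].
have Hs h' : h' \in s -> Int_assoc h' F by move=> hs; apply: H; rewrite inE hs orbT.
have [u hu E] := IH Hs.
have [w hw Eh] := H h (mem_head _ _).
exists (w * u); first exact: Int_unitM.
by rewrite big_cons E Eh /= exprS mulrACA.
Qed.

(** An irreducible factor, with the product of the others as cofactor, is a unit times a power of
    [F], and irreducibility makes the exponent 1. Degrees then give the number of factors. *)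
Lemma factorization_below k s : (k < S)%N -> Int_factorization (F ^+ k) s ->
  (forall h, h \in s -> Int_assoc h F) /\ size s = k.
Proof.
move=> kS [irr E].
have A : forall h, h \in s -> Int_assoc h F.
  move=> h hs; move: E; rewrite (perm_big _ (perm_to_rem hs)) big_cons => E.
  have hI : IntR h by case: (irr h hs).
  have hR : IntR (\prod_(x <- rem h s) x).
    by apply: IntR_prod => x /mem_rem/irr[].
  have [j1 [j2 [u1 [u2 [j12 hu1 hu2 E1 E2]]]]] := divisor_divpnX_below kS hI hR E.
  have j1E : j1 = 1%N by apply: (irr_unit_mul_divpnX hu1); rewrite -E1; exact: irr.
  by exists u1; rewrite // E1 j1E expr1.
split=> //; have [u hu Eu] := prod_assoc_divpn A.
by apply: (unit_mul_divpnX_inj hu (Int_unit1 R)); rewrite -Eu E mul1r.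
Qed.

Lemma Int_assoc_sym (a b : {poly K}) : Int_assoc a b -> Int_assoc b a.
Proof.
move=> [u /Int_unitP[t ht ->] ->]; exists (toK t^-1)%:P.
  by apply/Int_unitP; exists t^-1; rewrite ?unitrV.
by rewrite mulrA -polyCM -rmorphM mulVr // rmorph1 mul1r.
Qed.

Lemma Int_assoc_trans (a b c : {poly K}) : Int_assoc a b -> Int_assoc b c -> Int_assoc a c.
Proof.
by move=> [u hu ->] [w hw ->]; exists (u * w); [exact: Int_unitM | rewrite mulrA].
Qed.

Lemma factors_uniquely_below k : (k < S)%N -> Int_factors_uniquely (F ^+ k).
Proof.
move=> kS s t /(factorization_below kS)[As zs] /(factorization_below kS)[At zt].
split; first by rewrite zs zt.
exists t; first exact: perm_refl.
move=> i hi; apply: Int_assoc_trans (As _ (mem_nth _ hi)) _.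
by apply/Int_assoc_sym/At/mem_nth; rewrite zt -zs.
Qed.

(** On the class [r.-1], which lies in [W(f)], [F ^+ k] takes unit values, hence so does [a], and a
    constant equals its value. This is the hypothesis of [Int_factorization_exists]. *)
Lemma const_divisor_unit k (a b : {poly K}) : IntR a -> IntR b -> a * b = F ^+ k ->
  (size a <= 1)%N -> Int_unit a.
Proof.
move=> ha hb E sa; have E' := divisor_divpnX E.
case: E' => u1 [u2 [z1 [z2 [e1 [e2 [hu1 hu2 Ea Eb [Ee Ez]]]]]]].
have s0 : (r.-1 < r.+2)%N by lia.
have [x cl] := class_inhabited s0.
rewrite Ea in ha; rewrite Eb in hb.
have h1 := IntR_monoval hu1 ha s0; have h2 := IntR_monoval hu2 hb s0.
have h12 : monoval r n z1 e1 r.-1 + monoval r n z2 e2 r.-1 = 0.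
  have := monoval_const r2 n2 k r.-1.
  have -> : (r.-1 == r) || (r.-1 == r.+1) = false by lia.
  move=> <-; rewrite /monoval addrACA Ez -big_split; congr (_ + _).
  by apply: eq_bigr => i _ /=; rewrite -mulrDl -(Ee i) PoszD.
have v0 : monoval r n z1 e1 r.-1 = 0 by lia.
have [t ht Et] := horner_monoK z1 e1 hu1 cl.
apply/Int_unitP; exists t => //.
move: Et; rewrite -Ea v0 expr0z mulr1 => <-.
by rewrite {2}(size1_polyC sa) hornerC -size1_polyC.
Qed.

(** The split exponents give [A * B = F ^+ S]. If a refinement of this product into irreducibles
    agreed with [S] copies of [F], all irreducible factors of [A] would be associated to [F], and
    [A] would be a unit times a power of [F], against its valuations on the classes [r] and
    [r.+1]. *)
Lemma not_factors_uniquely_threshold : ~ Int_factors_uniquely (F ^+ S).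
Proof.
move=> uniq.
pose zA := - (n * (n.+1 * (n.-1) ^ r.-2))%N%:Z.
pose zB := - (n * (n.+1 * (n.-1) ^ r.-1))%N%:Z.
pose A := monoK 1 zA (splitexp1 r n); pose B := monoK 1 zB (splitexp2 r n).
have hA : IntR A.
  by apply: monoK_IntR; rewrite ?unitr1 // => s; case: (splitexp_monoval r2 n2 s).
have hB : IntR B.
  by apply: monoK_IntR; rewrite ?unitr1 // => s; case: (splitexp_monoval r2 n2 s).
have AB : A * B = F ^+ S.
  rewrite monoKM divpnX mulr1 /monoK.
  have -> : zA + zB = - (S * n)%N%:Z by rewrite /zA /zB /threshold; nia.
  by congr (_ *: toKX _); apply: eq_mono => i _; rewrite splitexp_sum.
have F0 : F ^+ S != 0.
  by rewrite expf_neq0 // -size_poly_gt0 (ltn_trans _ size_divpn).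
have notpow u j : Int_unit u -> A <> u * F ^+ j.
  move=> /Int_unitP[t ht ->] E.
  have [a ca] := class_inhabited (leqnSn r.+1 : (r < r.+2)%N).
  have [b cb] := class_inhabited (ltnSn r.+1).
  have val x s : in_class x s -> (s == r) || (s == r.+1) ->
      monoval r n zA (splitexp1 r n) s = j%:Z.
    move=> cx hs; have [y hy Ey] := horner_monoK zA (splitexp1 r n) (unitr1 _) cx.
    have [y' hy' Ey'] := horner_monoK (- (j * n)%N%:Z) (fun=> j) (unitr1 _) cx.
    rewrite -divpnX monoval_const // hs in Ey'.
    apply: (toK_unit_exp_inj dvr hy (_ : t * y' \is a GRing.unit)); first by rewrite unitrM ht.
    by rewrite -Ey [X in X.[_]](E : monoK _ _ _ = _) hornerM hornerC Ey' rmorphM mulrA.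
  have := splitexp1_monoval_neq r2 n2 zA.
  by rewrite (val a r) ?eqxx // (val b r.+1) ?eqxx ?orbT.
have nuA : ~ Int_unit A.
  by move=> U; apply: (notpow A 0%N U); rewrite expr0 mulr1.
have fac G H := @Int_factorization_exists _ _ F0 (fun a b => @const_divisor_unit _ a b) G H.
have [sA [iA pA]] := fac _ _ hA hB AB nuA.
have FS : Int_factorization (F ^+ S) (nseq S F).
  split; first by move=> h /nseqP[-> _]; exact: divpn_irr.
  by rewrite big_nseq iter_mulr_1.
have ABs : exists sB, Int_factorization (F ^+ S) (sA ++ sB).
  (* Were [B] a unit, [A] would be associated to [F ^+ S], which [notpow] excludes. *)
  case: (classic (Int_unit B)) => [U|nuB].
    exfalso; case/Int_unitP: U => y hy EB; apply: (notpow (toK y^-1)%:P S).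
      by apply/Int_unitP; exists y^-1; rewrite ?unitrV.
    by rewrite -AB EB mulrCA -polyCM -rmorphM mulVr // rmorph1 mulr1.
  have BA : B * A = F ^+ S by rewrite mulrC.
  have [sB [iB pB]] := fac _ _ hB hA BA nuB.
  exists sB; split; last by rewrite big_cat pA pB.
  by move=> h; rewrite mem_cat => /orP[/iA|/iB].
case: ABs => sB Fs; have [zs [t' pt at']] := uniq _ _ Fs FS.
have assoc h : h \in sA -> Int_assoc h F.
  move=> hs; have hi : (index h (sA ++ sB) < size (sA ++ sB))%N.
    by rewrite index_mem mem_cat hs.
  have := at' _ hi; rewrite nth_index ?mem_cat ?hs //.
  suff -> : t'`_(index h (sA ++ sB)) = F by [].
  have : t'`_(index h (sA ++ sB)) \in t'.
    by apply: mem_nth; rewrite -(perm_size pt) -zs.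
  by rewrite -(perm_mem pt) => /nseqP[].
have [u hu Eu] := prod_assoc_divpn assoc.
by apply: (notpow u (size sA) hu); rewrite -pA.
Qed.

Lemma divpn_not_abs_irr : ~ Int_abs_irr F.
Proof. by case=> _ /(_ S); exact: not_factors_uniquely_threshold. Qed.

(** * Irreducible divisors, fixed divisor and kernel of [f] *)

Lemma g_inj i j : (i <= r)%N -> (j <= r)%N -> g i = g j -> i = j.
Proof.
wlog ij : i j / (i <= j)%N => [H hi hj E|hi hj E].
  by case/orP: (leq_total i j) => h; [exact: H|symmetry; exact: H].
move: ij; rewrite leq_eqVlt => /orP[/eqP//|ij].
have [s hs /eqP ne] := valmx_columns_distinct r2 n2 ij hj.
have [a cl] := class_inhabited hs.
have [u hu Eu] := cl i hi; have [t ht Et] := cl j hj.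
by case: ne; apply: (unit_mul_expp_inj dvr hu ht); rewrite -Eu -Et E.
Qed.

Lemma g_size i : (i <= r)%N -> (1 < size (g i))%N.
Proof.
move=> /g_irr[+ _]; rewrite size_map_inj_poly ?rmorph0 //; exact: toK_inj.
Qed.

Lemma g_nonunit i : (i <= r)%N -> g i \isn't a GRing.unit.
Proof. by move=> /g_size h; rewrite poly_unitE; case: eqP h => // ->. Qed.

Lemma lead_coef_monic_factor (a b : {poly R}) : a * b \is monic ->
  lead_coef a \is a GRing.unit.
Proof.
by move=> /monicP; rewrite lead_coefM => E; apply/unitrPr; exists (lead_coef b).
Qed.

Lemma size_toKX (a : {poly R}) : size (toKX a) = size a.
Proof. by apply: size_map_inj_poly; [exact: toK_inj | exact: rmorph0]. Qed.

(** Serves the passage from [K[x]] back to [R[x]]: factors of a monic polynomial have unit leading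
    coefficients, so no nonunit constant splits off. *)
Lemma const_monic_factor (a b : {poly R}) (c : K) : a * b \is monic ->
  toKX a = c%:P -> a \is a GRing.unit.
Proof.
move=> /lead_coef_monic_factor la E.
have sa : (size a <= 1)%N by rewrite -size_toKX E size_polyC leq_b1.
by move: la; rewrite (size1_polyC sa) lead_coefC; exact: (rmorph_unit polyC).
Qed.

Lemma g_pirr i : (i <= r)%N -> pirr (g i).
Proof.
move=> ir; split; [exact/monic_neq0/g_monic|exact: g_nonunit|move=> a b E].
have E1 : toKX a * toKX b = 1 *: toKX (mono (fun j => (j == i)%N)).
  by rewrite scale1r mono_delta // E rmorphM.
have [e1 [e2 [ca [cb [Ea Eb Ee _]]]]] := divisor_mono (oner_neq0 _) E1.
have m1 : a * b \is monic by rewrite -E g_monic.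
have m2 : b * a \is monic by rewrite mulrC.
have z e : (forall j, e j <= (j == i))%N -> e i = 0%N -> mono e = 1.
  move=> le e0; rewrite -mono0; apply: eq_mono => j _.
  by have := le j; case: (j =P i) => [->|_]; rewrite ?e0 //=; lia.
have [e10|e10] := eqVneq (e1 i) 0%N; [left|right].
  apply: (const_monic_factor (c := ca) m1); rewrite Ea z ?rmorph1 ?alg_polyC //.
  by move=> j; rewrite -Ee leq_addr.
apply: (const_monic_factor (c := cb) m2); rewrite Eb z ?rmorph1 ?alg_polyC //.
  by move=> j; rewrite -Ee leq_addl.
by have := Ee i; rewrite eqxx /=; lia.
Qed.

Lemma g_dvd i : (i <= r)%N -> rdvd (g i) f.
Proof.
move=> ir; exists (mono (fun j => 1 - (j == i))%N).
by rewrite mulrC -(mono_pull (e := fun=> 1%N)).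
Qed.

(** By [divisor_mono], [h] is its leading coefficient, a unit, times a product of the [g i]. As a
    nonunit it contains some [g i], and irreducibility makes the remaining factor a unit. *)
Lemma pirr_divisor h : pirr h -> rdvd h f -> exists2 i, (i <= r)%N & passoc h (g i).
Proof.
move=> [h0 hu irr] [c Ef].
have E1 : toKX h * toKX c = 1 *: toKX (mono (fun=> 1%N)).
  by rewrite scale1r -/f Ef rmorphM mulrC.
have [e1 [e2 [ca [cb [Eh _ Ee _]]]]] := divisor_mono (oner_neq0 _) E1.
have lh : lead_coef h \is a GRing.unit.
  by apply: (@lead_coef_monic_factor h c); rewrite mulrC -Ef mono_monic.
have Eca : ca = toK (lead_coef h).
  have := congr1 lead_coef Eh; rewrite lead_coefZ (monicP (monic_map _ (mono_monic _))) mulr1.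
  by rewrite lead_coef_map_inj ?rmorph0 //; exact: toK_inj.
have hE : h = lead_coef h *: mono e1.
  by apply: (map_inj_poly (@toK_inj R) (rmorph0 _)); rewrite Eh Eca map_polyZ.
have [/forallP e0|] := boolP [forall i : 'I_r.+1, e1 i == 0]%N.
  case/negP: hu; rewrite hE; have -> : mono e1 = 1.
    rewrite -mono0; apply: eq_mono => i ir.
    by have /eqP := e0 (Ordinal (ir : (i < r.+1)%N)).
  by rewrite alg_polyC; exact: (rmorph_unit polyC).
rewrite negb_forall => /existsP[[i ir0] /= ei]; rewrite -lt0n in ei.
have ir : (i <= r)%N by rewrite -ltnS.
exists i => //.
have E2 : h = g i * (lead_coef h *: mono (fun j => e1 j - (j == i))%N).
  by rewrite {1}hE (mono_pull ir ei) -scalerAr.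
case: (irr _ _ E2) => U; first by rewrite (negbTE (g_nonunit ir)) in U.
by exists (lead_coef h *: mono (fun j => e1 j - (j == i))%N); rewrite // mulrC.
Qed.

Lemma val_f a s : in_class a s ->
  f.[a] != 0 /\ v f.[a] = (n + ((s == r) || (s == r.+1)))%N.
Proof.
move=> cl; have [u hu E] := horner_mono (fun=> 1%N) cl; rewrite -/f in E.
have u0 : u != 0 by apply: contraTneq hu => ->; rewrite unitr0.
split; first by rewrite E mulf_neq0 ?expf_neq0 ?(uniformizer_neq0 dvr).
rewrite E (valE dvr) //; have := monoval_const r2 n2 1 s; rewrite /monoval mul1n.
have -> : \sum_(i < r.+1) 1%:Z * (valmx r n s i)%:R = (\sum_(i < r.+1) 1 * valmx r n s i)%N%:Z.
  by rewrite -[RHS]natz natr_sum; apply: eq_bigr => i _; rewrite mul1n mul1r.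
by case: (_ || _) => /=; lia.
Qed.

Lemma vd_eq_f : vd_eq v f n.
Proof.
split.
  have s0 : (r.-1 < r.+2)%N by lia.
  have [a cl] := class_inhabited s0; exists a; have [h ->] := val_f cl; split=> //.
  have -> : (r.-1 == r) || (r.-1 == r.+1) = false by lia.
  by rewrite addn0.
by move=> b _; have [s cl] := class_exists b; have [_ ->] := val_f cl; exact: leq_addr.
Qed.

Lemma inW_class a s : in_class a s -> inW v f a <-> s != r /\ s != r.+1.
Proof.
move=> cl; have [f0 fv] := val_f cl; rewrite /inW fv; split=> [[_ [_]]|[/negbTE-> /negbTE->]].
  have [[b [b0 bv]] _] := vd_eq_f; move/(_ b b0); rewrite bv.
  by case: (s == r); case: (s == r.+1) => //=; lia.
by rewrite addn0; split=> //; exact: vd_eq_f.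
Qed.

Lemma val_passoc h i a s : (i <= r)%N -> passoc h (g i) -> in_class a s ->
  v h.[a] = valmx r n s i.
Proof.
move=> ir [u]; rewrite poly_unitE => /andP[/eqP su hu] -> cl; have [t ht E] := cl i ir.
rewrite hornerM E (size1_polyC (eq_leq su)) hornerC mulrA (valE dvr) //.
by rewrite unitrM hu.
Qed.

Lemma primitive_f : primitive f.
Proof.
move=> c H; have [d] := H (size f).-1; rewrite -[f`__]/(lead_coef f).
by rewrite (monicP (mono_monic _)) => E; apply/unitrPr; exists d; rewrite mulrC.
Qed.

Section DivisorSet.
Variable P : seq {poly R}.
Hypothesis P_div : irr_div_set f P.

(** An irreducible divisor set lists the [g i] in arbitrary order and up to units; [sg] and [tau]
    translate between its positions and the columns of [valmx]. *)
Lemma divisor_set_enum : exists (sg : 'I_(size P) -> nat) (tau : nat -> 'I_(size P)),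
  [/\ forall j, (sg j <= r)%N, forall i, (i <= r)%N -> sg (tau i) = i,
      forall j, tau (sg j) = j & forall j : 'I_(size P), passoc P`_j (g (sg j))].
Proof.
case: P_div => P1 P2 P3.
have /fin_all_exists[sg Hsg] : forall j : 'I_(size P), exists i, (i <= r)%N /\ passoc P`_j (g i).
  move=> j; have [h1 h2] := P1 _ (mem_nth 0 (ltn_ord j)).
  by have [i ir A] := pirr_divisor h1 h2; exists i.
have passoc_sym h h' : passoc h h' -> passoc h' h.
  by move=> [u hu ->]; exists u^-1; rewrite ?unitrV // mulKr.
have passoc_trans h1 h2 h3 : passoc h1 h2 -> passoc h2 h3 -> passoc h1 h3.
  by move=> [u hu ->] [t ht ->]; exists (u * t); rewrite ?unitrM ?hu // mulrA.
have /fin_all_exists[tau Htau] : forall i : 'I_r.+1, exists j, sg j = i.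
  move=> i; have ir : (i <= r)%N by rewrite -ltnS.
  have [h hP A] := P3 _ (g_pirr ir) (g_dvd ir).
  exists (Ordinal (etrans (index_mem h P) hP)).
  set j := Ordinal _; have [jr jA] := Hsg j.
  apply: g_inj => //; have [|u hu E] := passoc_trans _ (g i) h (g (sg j)) A.
    by move: jA; rewrite nth_index.
  (* Associated monic polynomials are equal: comparing leading coefficients shows that the unit is
     1. *)
  have lu := congr1 lead_coef E.
  move: hu; rewrite poly_unitE => /andP[/eqP su _].
  rewrite lead_coefM (monicP (g_monic ir)) (monicP (g_monic jr)) mulr1 in lu.
  have Eu := size1_polyC (eq_leq su); rewrite Eu lead_coefC in lu.
  by rewrite E Eu -lu mul1r.
exists sg, (fun i => tau (inord i)); split.
- by move=> j; have [] := Hsg j.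
- by move=> i ir; rewrite Htau inordK.
- move=> j; apply: val_inj; have [jr jA] := Hsg j.
  apply: P2; rewrite ?ltn_ord //.
  have [_ A] := Hsg (tau (inord (sg j))); apply: passoc_trans A _.
  by rewrite Htau inordK //; exact: passoc_sym.
- by move=> j; have [] := Hsg j.
Qed.

Section Enumerated.
Variables (sg : 'I_(size P) -> nat) (tau : nat -> 'I_(size P)).
Hypotheses (sg_le : forall j, (sg j <= r)%N) (tauK : forall i, (i <= r)%N -> sg (tau i) = i).
Hypotheses (sgK : forall j, tau (sg j) = j) (sgP : forall j : 'I_(size P), passoc P`_j (g (sg j))).

Lemma tau_bij : bijective (fun i : 'I_r.+1 => tau i).
Proof.
exists (fun j => inord (sg j)) => [i|j]; last by rewrite inordK ?ltnS.
by apply: val_inj; rewrite /= tauK ?inordK ?ltnS // -ltnS.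
Qed.

Lemma size_divisor_set : size P = r.+1.
Proof. by have := bij_eq_card tau_bij; rewrite !card_ord. Qed.

(** Reindexed along [tau], the conditions at the elements of [W(f)] are the rows of [valmx] other
    than [r] and [r.+1]; those below [r] already cut out the line spanned by [kergen]. *)
Lemma in_fdkE (u : 'I_(size P) -> rat) :
  in_fdk v f P u <-> exists c : rat, forall j, u j = c * (kergen r n (sg j))%:~R.
Proof.
have sumE a s : in_class a s -> \sum_(j < size P) u j * (v (P`_j).[a])%:R =
    \sum_(i < r.+1) u (tau i) * (valmx r n s i)%:R.
  move=> cl; rewrite (reindex _ (onW_bij _ tau_bij)) /=.
  apply: eq_bigr => i _; rewrite (val_passoc _ (sgP _) cl) // tauK //.
  by rewrite -ltnS.
split=> [H|[c Hc] a aW].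
  have K s : (s < r)%N -> \sum_(i < r.+1) u (tau i) * (valmx r n s i)%:R = 0.
    move=> sr; have s0 : (s < r.+2)%N by lia.
    have [a cl] := class_inhabited s0; rewrite -(sumE a s cl); apply: H.
    by apply/(inW_class cl); split; lia.
  have X := kernel_valmx r2 n2 (x := fun i => u (tau i)) K.
  by exists ((kergen r n r.-1)%:~R * u (tau r.-1)) => j; rewrite -X // sgK.
have [s cl] := class_exists a; have [s1 s2] := (inW_class cl).1 aW.
rewrite (sumE a s cl).
transitivity (c * (\sum_(i < r.+1) kergen r n i * (valmx r n s i)%:R)%:~R).
  rewrite rmorph_sum mulr_sumr; apply: eq_bigr => i _.
  have ir : (i <= r)%N by rewrite -ltnS.
  by rewrite Hc tauK // rmorphM /= rmorph_nat mulrA.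
by rewrite kergen_in_kernel // mulr0.
Qed.

(** The kernel is a line in a space of dimension [r.+1]. Transposition turns it into the row kernel
    [kermx], to which rank-nullity applies. *)
Lemma rank_fdp_matrix k (A : 'M[rat]_(k, size P)) : fdp_matrix v f P A -> \rank A = r.
Proof.
move=> HA; pose y : 'rV[rat]_(size P) := \row_j (kergen r n (sg j))%:~R.
have kerE (x : 'rV[rat]_(size P)) : x *m A^T = 0 <-> exists c : rat, x = c *: y.
  have -> : x *m A^T = 0 <-> A *m x^T = 0.
    by split=> E; apply: trmx_inj; rewrite trmx_mul trmxK E trmx0.
  rewrite HA in_fdkE; split=> -[c Hc]; exists c.
    by apply/rowP => j; rewrite !mxE -Hc mxE.
  by move=> j; rewrite Hc !mxE.
have ky : (kermx A^T :=: y)%MS.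
  apply/eqmxP/andP; split; last by rewrite sub_kermx; apply/eqP/kerE; exists 1; rewrite scale1r.
  apply/row_subP => i; have /kerE[c ->] : row i (kermx A^T) *m A^T = 0.
    by rewrite -row_mul mulmx_ker row0.
  exact: scalemx_sub.
have y0 : y != 0.
  apply/eqP => /rowP /(_ (tau r.-1)); rewrite !mxE tauK; last by lia.
  by case: (kergen_unit r2 n2) => ->.
have := mxrank_ker A^T; rewrite ky rank_rV y0 mxrank_tr.
have sP := size_divisor_set; have rA := rank_leq_col A.
by move: (\rank A) rA => d; lia.
Qed.

Lemma bigmax_eq_attained m (h : 'I_m -> nat) N j :
  (forall i, (h i <= N)%N) -> h j = N -> (\max_(i < m) h i)%N = N.
Proof.
move=> H E; apply/eqP; rewrite eqn_leq -{2}E leq_bigmax andbT.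
by apply/bigmax_leqP => i _.
Qed.

(** The integral kernel consists of the integer multiples [d w] of the generator; for [d] nonzero,
    the entries at the columns 0 and 1 have opposite signs and bound the two maxima. *)
Lemma min_norm_divisor_set : min_norm_fdk v f P ((n.-1) ^ r.-1 + (n.-1) ^ r.-2)%N.
Proof.
have [k0 k1] := (kergen0 r2 n2, kergen1 r2 n2).
have t0 : sg (tau 0%N) = 0%N by rewrite tauK.
have t1 : sg (tau 1%N) = 1%N by rewrite tauK //; lia.
have hA : (0 < n.-1 ^ r.-1)%N by rewrite expn_gt0; lia.
have hB : (0 < n.-1 ^ r.-2)%N by rewrite expn_gt0; lia.
split.
  exists (fun j => kergen r n (sg j)); split; first by exists (tau 0%N); rewrite t0 k0; lia.
  split; first by apply/in_fdkE; exists 1 => j; rewrite mul1r.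
  rewrite /norm_pm; congr (_ + _)%N.
    apply: (bigmax_eq_attained (j := tau 0%N)) => [j|]; last by rewrite t0 k0; lia.
    by have := kergen_bounds r2 n2 (sg j); lia.
  apply: (bigmax_eq_attained (j := tau 1%N)) => [j|]; last by rewrite t1 k1; lia.
  by have := kergen_bounds r2 n2 (sg j); lia.
move=> x [j0 xj0] /in_fdkE[c Hc].
have [d Hd] : exists d : int, forall j, x j = d * kergen r n (sg j).
  have tr : sg (tau r.-1) = r.-1 by rewrite tauK //; lia.
  (* The rational coefficient [c] is read off at [r.-1], where the generator is [+1] or [-1]; hence
     it is an integer. *)
  exists (x (tau r.-1) * kergen r n r.-1) => j; apply: (@intr_inj rat).
  rewrite !rmorphM /= !Hc tr.
  by case: (kergen_unit r2 n2) => ->; rewrite ?rmorphN ?rmorph1; ring.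
have d0 : d != 0 by apply: contraNneq xj0 => d0; rewrite Hd d0 mul0r.
have x0 : x (tau 0%N) = d * (n.-1 ^ r.-1)%N%:Z by rewrite Hd t0 k0.
have x1 : x (tau 1%N) = - (d * (n.-1 ^ r.-2)%N%:Z) by rewrite Hd t1 k1 mulrN.
have pos j : (absz (Num.max (x j) 0) <= \max_(i < size P) absz (Num.max (x i) 0)%R)%N.
  exact: (leq_bigmax (F := fun i => absz (Num.max (x i) 0))).
have neg j : (absz (Num.max (- x j) 0) <= \max_(i < size P) absz (Num.max (- x i) 0)%R)%N.
  exact: (leq_bigmax (F := fun i => absz (Num.max (- x i) 0))).
rewrite /norm_pm; move: (pos (tau 0%N)) (pos (tau 1%N)) (neg (tau 0%N)) (neg (tau 1%N)).
rewrite x0 x1; set U := (\max_(i < _) _)%N; set V := (\max_(i < _) _)%N.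
move: hA hB; set A := (_ ^ _)%N; set B := (_ ^ _)%N => hA hB.
have [dp|dn] : 1 <= d \/ d <= -1 by lia.
  have a : A%:Z <= d * A%:Z by apply: ler_peMl => //; lia.
  have b : B%:Z <= d * B%:Z by apply: ler_peMl => //; lia.
  by lia.
have dn' : 1 <= - d by lia.
have a : A%:Z <= - d * A%:Z by apply: ler_peMl => //; lia.
have b : B%:Z <= - d * B%:Z by apply: ler_peMl => //; lia.
by lia.
Qed.

End Enumerated.
End DivisorSet.
End Monomials.

(** * The localization of the integers at a prime *)

Section LocalRing.
Variables (R : idomainType) (p : R) (v : R -> nat).
Hypothesis dvr : is_dvr p v.

Lemma unit_or_dvd (a : R) : a \is a GRing.unit \/ rdvd p a.
Proof.
have [->|a0] := eqVneq a 0; first by right; exists 0; rewrite mul0r.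
case: dvr => _ _ H; have [u hu ->] := H a a0; case: (v a) => [|k].
  by left; rewrite expr0 mulr1.
by right; exists (u * p ^+ k); rewrite -mulrA -exprSr.
Qed.

Lemma unit_add_mulp (u y : R) : u \is a GRing.unit -> u + p * y \is a GRing.unit.
Proof.
move=> hu; case: (unit_or_dvd (u + p * y)) => // -[c E].
have Eu : u = p * (c - y) by rewrite mulrBr [p * c]mulrC -E addrK.
by case: dvr => _ /negP[]; move: hu; rewrite Eu unitrM => /andP[].
Qed.

End LocalRing.

Definition locint (q : nat) : pred rat := fun x => coprime q `|denq x|.

(** The reduced denominator divides any other one, so a single fraction with denominator prime to
    [q] suffices. *)
Lemma locintP (q : nat) (x : rat) (a b : int) :
  coprime q `|b| -> x * b%:~R = a%:~R -> locint q x.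
Proof.
move=> cb E; apply: coprime_dvdr cb.
have : numq x * b = a * denq x.
  by apply: (@intr_inj rat); rewrite !rmorphM /= -E numqE; ring.
move=> /(congr1 absz); rewrite !abszM => E'.
rewrite -(Gauss_dvdr (n := `|numq x|)); last by rewrite coprime_sym coprime_num_den.
by rewrite E' dvdn_mull.
Qed.

Lemma locint_subring (q : nat) : subring_closed (locint q).
Proof.
have coM (x y : rat) : locint q x -> locint q y -> coprime q `|denq x * denq y|.
  by move=> hx hy; rewrite abszM coprimeMr; apply/andP.
split=> [|x y hx hy|x y hx hy].
- exact: coprimen1.
- apply: (locintP (a := numq x * denq y - numq y * denq x) (coM _ _ hx hy)).
  by rewrite rmorphB !rmorphM /= !numqE; ring.
- apply: (locintP (a := numq x * numq y) (coM _ _ hx hy)).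
  by rewrite !rmorphM /= !numqE; ring.
Qed.

HB.instance Definition _ (q : nat) :=
  GRing.isSubringClosed.Build rat (locint q) (locint_subring q).

Record zloc (q : nat) := Zloc { zval :> rat; _ : zval \in locint q }.

HB.instance Definition _ (q : nat) := [isSub for @zval q].
HB.instance Definition _ (q : nat) := [Choice of zloc q by <:].
HB.instance Definition _ (q : nat) := [SubChoice_isSubComNzRing of zloc q by <:].

Definition zloc_unit (q : nat) : pred (zloc q) :=
  fun x => (zval x != 0) && ((zval x)^-1 \in locint q).

(** The default [x] of [insubd] leaves nonunits fixed, as the unit ring structure demands; 0 is
    fixed because its inverse in [rat] is 0. *)
Definition zloc_inv (q : nat) (x : zloc q) : zloc q := insubd x (zval x)^-1.

Lemma zloc_mulVr q : {in @zloc_unit q, left_inverse 1 (@zloc_inv q) *%R}.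
Proof.
move=> x /andP[x0 hx]; apply: val_inj; rewrite rmorphM rmorph1 /zloc_inv /=.
by rewrite val_insubd hx mulVf.
Qed.

Lemma zloc_unitPl q (x y : zloc q) : y * x = 1 -> x \in @zloc_unit q.
Proof.
move=> /(congr1 val); rewrite rmorphM rmorph1 /= => E.
have x0 : zval x != 0.
  by apply: contra_eq_neq E => ->; rewrite mulr0 eq_sym oner_neq0.
rewrite unfold_in /zloc_unit x0 /=.
by have -> : (zval x)^-1 = zval y; [apply: (mulIf x0); rewrite mulVf | exact: valP].
Qed.

Lemma zloc_inv_out q : {in [predC @zloc_unit q], @zloc_inv q =1 id}.
Proof.
move=> x; rewrite inE unfold_in /zloc_unit negb_and negbK => hx.
apply: val_inj; rewrite /zloc_inv val_insubd; case: ifP => // h.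
by move: hx; rewrite h orbF /= => /eqP ->; rewrite invr0.
Qed.

HB.instance Definition _ (q : nat) := GRing.ComNzRing_hasMulInverse.Build (zloc q)
  (@zloc_mulVr q) (@zloc_unitPl q) (@zloc_inv_out q).

Lemma zloc_idomain q (x y : zloc q) : x * y = 0 -> (x == 0) || (y == 0).
Proof.
move=> /(congr1 val); rewrite rmorphM rmorph0 /= => /eqP; rewrite mulf_eq0.
by case/orP=> /eqP h; apply/orP; [left|right]; apply/eqP/val_inj; rewrite rmorph0.
Qed.

HB.instance Definition _ (q : nat) :=
  GRing.ComUnitRing_isIntegral.Build (zloc q) (@zloc_idomain q).

Section LocalizedIntegers.
Variable q : nat.
Hypothesis q_prime : prime q.
Local Notation Zq := (zloc q).
Local Notation p := (q%:R : Zq).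

Lemma zval_int (z : int) : zval (z%:~R : Zq) = z%:~R.
Proof. exact: (rmorph_int (val : {rmorphism Zq -> rat})). Qed.

Lemma zloc_int_inj : injective (fun z : int => z%:~R : Zq).
Proof. by move=> y z /(congr1 val); rewrite /= !zval_int => /intr_inj. Qed.

Lemma zloc_quotient (a b : int) : coprime q `|b| -> exists c : Zq, c * b%:~R = a%:~R.
Proof.
move=> cb; have b0 : b != 0.
  by apply: contraTneq cb => ->; rewrite /coprime gcdn0; have := prime_gt1 q_prime; lia.
have h : a%:~R / b%:~R \in locint q.
  by apply: (locintP (a := a) cb); rewrite divfK // intr_eq0.
exists (Zloc h); apply: val_inj; rewrite rmorphM /= !zval_int.
by rewrite divfK // intr_eq0.
Qed.

Lemma zloc_repr (x : Zq) : exists a b : int, coprime q `|b| /\ x * b%:~R = a%:~R.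
Proof.
exists (numq (zval x)), (denq (zval x)); split; first exact: (valP x).
by apply: val_inj; rewrite rmorphM /= !zval_int numqE.
Qed.

Lemma zloc_int_dvd (z : int) : rdvd p (z%:~R) -> (q %| z)%Z.
Proof.
move=> [c E]; have [a [b [cb Ec]]] := zloc_repr c.
have E' : z * b = a * q%:Z.
  apply: zloc_int_inj; rewrite !rmorphM /= E -Ec.
  by rewrite -[q%:R]/(q%:Z%:~R); ring.
rewrite dvdzE /= -(@Gauss_dvdl _ _ `|b|) //.
by rewrite -abszM E' abszM /= dvdn_mull.
Qed.

Lemma zloc_int_unit (z : int) : coprime q `|z| -> (z%:~R : Zq) \is a GRing.unit.
Proof.
move=> cz; have [c E] := zloc_quotient 1 cz; apply/unitrPr; exists c.
by rewrite mulrC E.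
Qed.

(** The reduced denominator is prime to [q], so the numerator carries the whole valuation. *)
Definition zloc_val (x : Zq) : nat := logn q `|numq (zval x)|.

Lemma zloc_dvr : is_dvr p zloc_val.
Proof.
split.
- by rewrite -(inj_eq val_inj) rmorph0 rmorph_nat pnatr_eq0 -lt0n prime_gt0.
- apply/negP => /unitrPr[c E].
  have /zloc_int_dvd : rdvd p (1%:~R) by exists c; rewrite mulrC E.
  by rewrite dvdz1 /= => /eqP q1; move: q_prime; rewrite q1.
move=> x x0; have zx0 : zval x != 0 by rewrite -(inj_eq val_inj) rmorph0 in x0.
have n0 : (0 < `|numq (zval x)|)%N by rewrite absz_gt0 numq_eq0.
have [m cm Em] := pfactor_coprime q_prime n0.
rewrite -/(zloc_val x) in Em.
have cd : coprime q `|denq (zval x)| by exact: (valP x).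
have [c Ec] := zloc_quotient 1 cd.
have xE : x * (denq (zval x))%:~R = (numq (zval x))%:~R.
  by apply: val_inj; rewrite rmorphM /= !zval_int numqE.
have sE : (numq (zval x))%:~R = ((-1) ^+ (numq (zval x) < 0)%R * m%:R * p ^+ zloc_val x : Zq).
  rewrite {1}[numq _]intEsign rmorphM /= {1}Em PoszM rmorphM rmorphXn rmorphN rmorph1 /= mulrA.
  by congr (_ * _); rewrite -natrX.
exists ((-1) ^+ (numq (zval x) < 0)%R * m%:R * c).
  rewrite !unitrM unitrX ?unitrN1 //= (@zloc_int_unit m) //=.
  by apply/unitrPr; exists (denq (zval x))%:~R; rewrite Ec.
by rewrite mulrAC -sE -xE -mulrA [_%:~R * c]mulrC Ec mulr1.
Qed.

Lemma zloc_residue (x : Zq) : exists2 s, (s < q)%N & rdvd p (x - s%:R).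
Proof.
have [a [b [cb E]]] := zloc_repr x.
have [c Ec] := zloc_quotient 1 cb.
have [[u t] /= Eut] : {ut : int * int | ut.1 * q%:Z + ut.2 * b = 1}.
  have [u [t ht]] := Bezoutz q b; exists (u, t).
  by rewrite /= ht /gcdz /=; move/eqP: cb => ->.
have q0 : q%:Z != 0 by rewrite eqz_nat -lt0n prime_gt0.
(* By the Bezout relation [t] inverts [b] modulo [q], so [a * t] represents the residue of the
   fraction [a / b]. *)
pose s := `|((a * t) %% q)%Z|%N.
have sE : s%:Z = ((a * t) %% q)%Z by rewrite /s gez0_abs // modz_ge0.
exists s; first by rewrite -ltz_nat sE ltz_pmod // ltz_nat prime_gt0.
pose k := (a * u + ((a * t) %/ q)%Z * b) : int.
have kE : a - s%:Z * b = k * q%:Z.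
  have := divz_eq (a * t) q; rewrite -sE /k; move: ((a * t) %/ q)%Z => d Ed.
  have -> : s%:Z = a * t - d * q%:Z by rewrite Ed; ring.
  by rewrite -{1}[a]mulr1 -Eut; ring.
exists (k%:~R * c); have E' : (x - s%:R) * b%:~R = (k%:~R * q%:R : Zq).
  rewrite mulrBl E -[s%:R]/(s%:Z%:~R) -rmorphM -rmorphB kE rmorphM /=.
  by [].
transitivity ((x - s%:R) * b%:~R * c); last by rewrite E' mulrAC.
by rewrite -mulrA [_ * c]mulrC Ec mulr1.
Qed.

Lemma zloc_finite_residue : finite_residue p.
Proof.
exists [seq s%:R | s <- iota 0 q] => a; have [s hs d] := zloc_residue a.
by exists s%:R => //; apply: map_f; rewrite mem_iota.
Qed.

Lemma zloc_residue_inj (x : Zq) s t : (s < q)%N -> (t < q)%N ->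
  rdvd p (x - s%:R) -> rdvd p (x - t%:R) -> s = t.
Proof.
move=> sq tq [c Ec] [d Ed].
have /zloc_int_dvd : rdvd p ((s%:Z - t%:Z)%:~R : Zq).
  exists (d - c); rewrite mulrBl -Ec -Ed rmorphB /=.
  by rewrite -[s%:R]/(s%:Z%:~R) -[t%:R]/(t%:Z%:~R); ring.
rewrite dvdzE /= => h; have : (`|s%:Z - t%:Z| < q)%N by lia.
by case: (posnP `|s%:Z - t%:Z|%N) => [|pos]; [lia | have := dvdn_leq pos h; lia].
Qed.

(** Irreducibility over the integers passes to [rat]. A divisor over the fraction field of [zloc q]
    is cleared of denominators, mapped to [rat] and compared with [G] there; its size then carries
    the conclusion back. *)
Lemma irreducible_zloc (G : {poly int}) : irreducible_poly G ->
  irreducible_poly (map_poly (@toK Zq) (map_poly intr G)).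
Proof.
move=> /irreducible_rat_int[sG irr].
have inj1 : injective (@toK Zq) := @toK_inj Zq.
have inj2 : injective (val : Zq -> rat) := val_inj.
have valG : map_poly (val : Zq -> rat) (map_poly intr G) = map_poly intr G.
  by apply/polyP => i; rewrite !coef_map /= zval_int.
have sz1 (h : {poly Zq}) : size (map_poly (@toK Zq) h) = size h.
  by apply: size_map_inj_poly; rewrite ?rmorph0.
have sz2 (h : {poly Zq}) : size (map_poly (val : Zq -> rat) h) = size h.
  by apply: size_map_inj_poly; rewrite ?rmorph0.
split; first by rewrite sz1 -sz2 valG.
move=> d sd dG; have := dG; rewrite dvdp_eq => /eqP; set e := _ %/ _ => E.
have [c1 c10 [d' Ed]] := clear_denominators d.
have [c2 c20 [e' Ee]] := clear_denominators e.
have E1 : (c1 * c2) *: map_poly intr G = e' * d'.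
  apply: (map_inj_poly inj1 (rmorph0 _)).
  rewrite map_polyZ rmorphM /= rmorphM /= -Ed -Ee E.
  by rewrite -scalerAl -scalerAr scalerA mulrC.
have E2 : val (c1 * c2) *: map_poly intr G =
    map_poly (val : Zq -> rat) e' * map_poly (val : Zq -> rat) d'.
  have := congr1 (map_poly (val : {rmorphism Zq -> rat})) E1.
  by rewrite map_polyZ [map_poly _ (e' * d')]rmorphM /= valG.
have c0 : val (c1 * c2) != 0.
  by rewrite -(rmorph0 (val : {rmorphism Zq -> rat})) (inj_eq val_inj) mulf_neq0.
have sd' : size d' = size d.
  by rewrite -sz1 -Ed size_scale // toK_eq0.
have nz : size (map_poly (val : Zq -> rat) d') != 1%N by rewrite sz2 sd'.
have dv : map_poly (val : Zq -> rat) d' %| map_poly intr G.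
  by rewrite -(dvdpZr _ _ c0) E2 dvdp_mull.
have sE := eqp_size (irr _ nz dv).
by rewrite -dvdp_size_eqp // sz1 -sz2 valG -sE sz2 sd'.
Qed.

(** * Irreducible polynomials with prescribed valuations *)

Section PrescribedValuations.
Variables (N : nat) (m : nat -> nat).
Hypotheses (q_odd : odd q) (m_lt : forall s, (m s < N)%N).
Hypothesis m_pos : exists2 s, (s < q)%N & (0 < m s)%N.

(** Off the class [s] the first term is a unit and [q ^ m s] is divisible by [q] as soon as
    [m s > 0], so the values are units there. For [m s = 0] this would fail, whence the separate
    case. *)
Definition local_factor (s : nat) : {poly int} :=
  if (0 < m s)%N then ('X - (s%:Z)%:P) ^+ N - ((q ^ m s)%N%:Z)%:P else 1.

Definition local_prod : {poly int} := \prod_(s < q) local_factor s.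

Let D := (size local_prod).-1.

(* Congruent to [local_prod] modulo [q ^ N], which preserves the valuations, and
   Eisenstein at 2, since [1 - q ^ (2 * N)] is divisible by 4. *)
Definition eisen_poly : {poly int} :=
  'X^D + (1 - (q ^ N)%N%:Z ^+ 2) *: (local_prod - 'X^D) + (2 * (q ^ N)%N%:Z)%:P.

Lemma N_gt0 : (0 < N)%N. Proof. exact: leq_ltn_trans (m_lt 0). Qed.

Lemma local_factor_size s : (0 < m s)%N ->
  local_factor s \is monic /\ size (local_factor s) = N.+1.
Proof.
move=> ms; rewrite /local_factor ms.
have mon : ('X - (s%:Z)%:P) ^+ N \is monic by apply/monic_exp/monicXsubC.
have sz : size (('X - (s%:Z)%:P) ^+ N) = N.+1 by rewrite size_exp_XsubC.
have lt : (size (- ((q ^ m s)%N%:Z)%:P) < size (('X - (s%:Z)%:P) ^+ N))%N.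
  by rewrite size_polyN sz ltnS (leq_trans (size_polyC_leq1 _)) ?N_gt0.
by split; [rewrite monicE lead_coefDl // -monicE | rewrite size_polyDl].
Qed.

Lemma local_factor_monic s : local_factor s \is monic.
Proof.
have [ms|/local_factor_size[]//] := posnP (m s).
by rewrite /local_factor ms monic1.
Qed.

Lemma local_prod_monic : local_prod \is monic.
Proof. by apply: monic_prod => s _; exact: local_factor_monic. Qed.

Lemma D_gt0 : (0 < D)%N.
Proof.
case: m_pos => s sq ms; rewrite /D /local_prod (bigD1 (Ordinal sq)) //=.
have [mon sz] := local_factor_size ms.
have mon' : \prod_(i < q | i != Ordinal sq) local_factor i \is monic.
  by apply: monic_prod => i _; exact: local_factor_monic.
rewrite size_monicM ?monic_neq0 // sz addSn /=.
by have := N_gt0; have := monic_neq0 mon'; rewrite -size_poly_gt0; case: size; lia.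
Qed.

Lemma size_local_prod : size local_prod = D.+1.
Proof. by rewrite /D prednK // size_poly_gt0 monic_neq0 // local_prod_monic. Qed.

Lemma coef_eisen_poly i : eisen_poly`_i = (i == D)%:R +
  (1 - (q ^ N)%N%:Z ^+ 2) * (local_prod`_i - (i == D)%:R) +
  (if i == 0%N then 2 * (q ^ N)%N%:Z else 0).
Proof. by rewrite /eisen_poly !coefD coefZ coefB coefXn coefC. Qed.

Lemma coef_eisen_poly_lead : eisen_poly`_D = 1.
Proof.
rewrite coef_eisen_poly eqxx -{2}[D]/((size local_prod).-1) -lead_coefE.
rewrite (monicP local_prod_monic) subrr mulr0 addr0.
have -> : (D == 0)%N = false by apply: negbTE; rewrite -lt0n D_gt0.
by rewrite addr0.
Qed.

Lemma size_eisen_poly : size eisen_poly = D.+1.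
Proof.
apply/eqP; rewrite eqn_leq; apply/andP; split.
  apply/leq_sizeP => j hj; rewrite coef_eisen_poly nth_default; last by rewrite size_local_prod.
  have -> : (j == D) = false by lia.
  have -> : (j == 0%N) = false by lia.
  by rewrite subr0 mulr0 !addr0.
by rewrite ltnNge; apply/negP => /leq_sizeP/(_ D (leqnn _))/eqP; rewrite coef_eisen_poly_lead.
Qed.

Lemma eisen_poly_monic : eisen_poly \is monic.
Proof. by rewrite monicE lead_coefE size_eisen_poly coef_eisen_poly_lead. Qed.

(** All coefficients below the leading one are even, and the constant one is congruent to [2 q ^ N]
    modulo 4, hence to 2 since [q] is odd. *)
Lemma eisen_poly_irr : irreducible_poly eisen_poly.
Proof.
have D0 := D_gt0; have oQ : odd (q ^ N) by rewrite oddX q_odd orbT.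
pose k := ((q ^ N)./2)%N%:Z.
have Qk : (q ^ N)%N%:Z = 2 * k + 1.
  by rewrite -{1}(odd_double_half (q ^ N)) oQ /k -muln2; lia.
have aE : 1 - (q ^ N)%N%:Z ^+ 2 = (- (k ^+ 2 + k)) * 4 by rewrite Qk; ring.
apply: (@eisenstein_crit 2) => //.
- by rewrite size_eisen_poly; lia.
- by rewrite (monicP eisen_poly_monic).
- rewrite coef_eisen_poly eqxx.
  have -> : (0 == D)%N = false by lia.
  rewrite aE Qk subr0 add0r; move: (local_prod`_0) => c.
  have -> : - (k ^+ 2 + k) * 4 * c + 2 * (2 * k + 1) =
      ((- (k ^+ 2 + k)) * c + k) * 4 + 2 by ring.
  by apply/negP => /dvdzP[e]; rewrite expr2 => E; lia.
- move=> i; rewrite size_eisen_poly /= => iD; rewrite coef_eisen_poly aE Qk.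
  have -> : (i == D) = false by lia.
  rewrite subr0 add0r; move: (local_prod`_i) => c.
  apply/dvdzP; case: ifP => _.
    by exists (- (k ^+ 2 + k) * 2 * c + (2 * k + 1)); ring.
  by exists (- (k ^+ 2 + k) * 2 * c); ring.
Qed.

Lemma eisen_polyE : exists E : {poly int}, eisen_poly = local_prod + (q%:Z ^+ N) *: E.
Proof.
exists ((q ^ N)%N%:Z *: ('X^D - local_prod) + 2%:P).
have -> : q%:Z ^+ N = (q ^ N)%N%:Z by rewrite -!natz natrX.
rewrite /eisen_poly -!mul_polyC polyCM polyCB polyC_exp.
have ringid (A : comNzRingType) (x l Q t : A) :
  x + (1 - Q ^+ 2) * (l - x) + t * Q = l + Q * (Q * (x - l) + t) by ring.
exact: ringid.
Qed.

Lemma horner_local_factor (x : Zq) s t : (s < q)%N -> (t < q)%N -> rdvd p (x - s%:R) ->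
  exists2 u, u \is a GRing.unit &
    (map_poly intr (local_factor t)).[x] = u * p ^+ (if t == s then m s else 0%N).
Proof.
move=> sq tq hx; rewrite /local_factor; case: posnP => mt.
  rewrite rmorph1 hornerC; exists 1; rewrite ?unitr1 // mul1r.
  by case: eqP => // <-; rewrite mt.
have -> : (map_poly intr (('X - (t%:Z)%:P) ^+ N - ((q ^ m t)%N%:Z)%:P)).[x] =
    (x - t%:R) ^+ N - p ^+ m t.
  rewrite rmorphB rmorphXn /= rmorphB /= map_polyX !map_polyC /= hornerD hornerN.
  by rewrite horner_exp hornerD hornerN hornerX !hornerC -natrX.
case: eqP => [->|ts].
  (* Since [m s < N], taking [p ^+ m s] out of [c ^+ N * p ^+ N - p ^+ m s] leaves [-1] modulo
     [p]. *)
  have [c ->] := hx; exists (-1 + p * (c ^+ N * p ^+ (N - m s).-1)).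
    by apply: (unit_add_mulp zloc_dvr); rewrite unitrN1.
  rewrite exprMn mulrDl mulN1r [RHS]addrC; congr (_ - _).
  have NE : N = ((N - m s).-1.+1 + m s)%N by have := m_lt s; lia.
  by rewrite {2}NE exprD exprS !mulrA [c ^+ N * _]mulrC.
exists ((x - t%:R) ^+ N + p * (- p ^+ (m t).-1)).
  apply: (unit_add_mulp zloc_dvr); apply: unitrX.
  case: (unit_or_dvd zloc_dvr (x - t%:R)) => // ht.
  by case: ts; apply: (zloc_residue_inj tq sq ht hx).
by rewrite expr0 mulr1 mulrN -exprS prednK.
Qed.

(** Only the local factor of [s] contributes to the valuation of the product, and a perturbation by
    a multiple of [p ^+ N] with [N > m s] changes the unit alone. *)
Lemma horner_eisen_poly (x : Zq) s : (s < q)%N -> rdvd p (x - s%:R) ->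
  exists2 u, u \is a GRing.unit & (map_poly intr eisen_poly).[x] = u * p ^+ m s.
Proof.
move=> sq hx; have [E ->] := eisen_polyE.
have [u hu Hu] : exists2 u, u \is a GRing.unit &
    (map_poly intr local_prod).[x] = u * p ^+ (\sum_(t < q) if t == s :> nat then m s else 0%N).
  rewrite /local_prod rmorph_prod horner_prod.
  elim/big_ind2: _ => [|x1 k1 x2 k2 [u1 h1 ->] [u2 h2 ->]|t _].
  - by exists 1; rewrite ?unitr1 // expr0 mulr1.
  - by exists (u1 * u2); rewrite ?unitrM ?h1 // exprD mulrACA.
  - exact: horner_local_factor.
rewrite (bigD1 (Ordinal sq)) //= eqxx big1 ?addn0 in Hu; last first.
  by move=> t ts; rewrite (negbTE (ts : (t : nat) != s)).
exists (u + p * (p ^+ (N - m s).-1 * (map_poly intr E).[x])).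
  exact: (unit_add_mulp zloc_dvr).
rewrite rmorphD /= map_polyZ hornerD hornerZ Hu mulrDl; congr (_ + _).
have NE : N = ((N - m s).-1.+1 + m s)%N by have := m_lt s; lia.
by rewrite rmorphXn /= {1}NE exprD exprS mulrAC !mulrA.
Qed.

End PrescribedValuations.
End LocalizedIntegers.

(** * Assembly of the construction *)

Unset Implicit Arguments.
Set Strict Implicit.

Theorem theorem4 (r n : nat) : (2 <= r)%N -> (2 <= n)%N ->
  exists (R : idomainType) (p : R) (v : R -> nat),
    is_dvr p v /\ finite_residue p /\
    exists f : {poly R},
      [/\ primitive f, (1 < size f)%N & vd_eq v f n] /\
      Int_irr (divpn p n f) /\ ~ Int_abs_irr (divpn p n f) /\
      (forall P, irr_div_set f P ->
         forall (k : nat) (A : 'M[rat]_(k, size P)),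
           fdp_matrix v f P A -> reduced A -> \rank A = r) /\
      exists S : nat,
        [/\ ~ Int_factors_uniquely (divpn p n f ^+ S),
            forall k : nat, (k < S)%N -> Int_factors_uniquely (divpn p n f ^+ k),
            S = (n.+1 * ((n.-1) ^ r.-1 + (n.-1) ^ r.-2))%N &
            forall P, irr_div_set f P ->
              exists2 m : nat, min_norm_fdk v f P m & S = (n.+1 * m)%N].
Proof.
(* A prime above [r.+2] is odd and leaves room for the [r.+2] distinguished residue classes. *)
move=> r2 n2; have [q rq q_prime] := prime_above r.+2.
have q_odd : odd q by case: (even_prime q_prime) rq => [->|//]; lia.
have col_pos (i : 'I_r.+1) : exists2 s, (s < q)%N & (0 < valmx r n s i)%N.
  have ir : (i <= r)%N by rewrite -ltnS.
  by have [s sr h] := valmx_positive_column r2 n2 ir; exists s => //; lia.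
(* [inord] confines the index to the columns of [valmx], where [col_pos] holds. *)
pose g (i : nat) : {poly zloc q} :=
  map_poly intr (eisen_poly q n.+2 (fun s => valmx r n s (inord i : 'I_r.+1))).
have m_lt i s : (valmx r n s i < n.+2)%N := valmx_lt r2 n2 s i.
have dvr := zloc_dvr q_prime.
have g_monic i : (i <= r)%N -> g i \is monic.
  by move=> ir; apply: monic_map; exact: (eisen_poly_monic q_prime q_odd (m_lt _) (col_pos _)).
have g_irr i : (i <= r)%N -> irreducible_poly (map_poly (@toK (zloc q)) (g i)).
  by move=> ir; apply: irreducible_zloc; exact: (eisen_poly_irr q_prime q_odd (m_lt _) (col_pos _)).
have classP a s : (s < q)%N -> rdvd q%:R (a - s%:R : zloc q) -> in_class q%:R r n g a s.
  move=> sq d i ir.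
  have [u hu E] := horner_eisen_poly q_prime q_odd (m_lt (inord i : 'I_r.+1)) sq d.
  by exists u => //; rewrite [LHS]E inordK.
have cl_ex a : exists s, in_class q%:R r n g a s.
  by have [s sq d] := zloc_residue q_prime a; exists s; exact: classP.
have cl_inh s : (s < r.+2)%N -> exists a, in_class q%:R r n g a s.
  move=> sr; exists s%:R; apply: classP; first by lia.
  by exists 0; rewrite subrr mul0r.
exists (zloc q), q%:R, (@zloc_val q); split=> //.
split; first exact: zloc_finite_residue.
exists (mono r g (fun=> 1%N)); split.
  by split; [exact: primitive_f | exact: (size_mono1 r2 n2 g_monic g_irr)
            | exact: (vd_eq_f dvr r2 n2 cl_ex cl_inh)].
split; first exact: (divpn_irr dvr r2 n2 g_monic g_irr cl_ex cl_inh).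
split; first exact: (divpn_not_abs_irr dvr r2 n2 g_monic g_irr cl_ex cl_inh).
split.
  move=> P hP k A hA _.
  have [sg [tau [h1 h2 h3 h4]]] := divisor_set_enum dvr r2 n2 g_monic g_irr cl_inh hP.
  exact: (rank_fdp_matrix dvr r2 n2 cl_ex cl_inh h1 h2 h3 h4 hA).
exists (threshold r n); split=> //.
- exact: (not_factors_uniquely_threshold dvr r2 n2 g_monic g_irr cl_ex cl_inh).
- exact: (factors_uniquely_below dvr r2 n2 g_monic g_irr cl_ex cl_inh).
move=> P hP; exists ((n.-1) ^ r.-1 + (n.-1) ^ r.-2)%N => //.
have [sg [tau [h1 h2 h3 h4]]] := divisor_set_enum dvr r2 n2 g_monic g_irr cl_inh hP.
exact: (min_norm_divisor_set dvr r2 n2 cl_ex cl_inh h1 h2 h3 h4).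
Qed.
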